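(* Let $X$ be a Hilbert space, let $A:D(A)\subset X\to X$ be a diagonalizable operator, and let $U$ be a Banach space. Suppose that $A$ generates a polynomially stable semigroup with parameter $\alpha>0$ on $X$. If $B\in\mathcal{L}(U,X)$ is a finite-rank operator and satisfies $\operatorname{ran}(B)\subset D((-A)^{\alpha})$, then the linear system $\Sigma_{\mathrm{lin}}(A,B)$ is polynomially ISS with parameter $\alpha$ for $\mathcal{U}=L^\infty(\mathbb{R}_+,U)$.
   Context: $\mathcal{L}(U,X)$ denotes the bounded linear operators from $U$ to $X$; $\operatorname{ran}(B)$ is the range of $B$; $\mathbb{R}_+=[0,\infty)$; $\|u\|_\infty=\operatorname{ess\,sup}_{t\ge0}\|u(t)\|_U$. The graph norm is $\|x\|_A:=\|x\|+\|Ax\|$, $x\in D(A)$. For real functions, $f(t)=O(g(t))$ as $t\to\infty$ means there are $M>0$, $t_0$ with $f(t)\le Mg(t)$ for $t\ge t_0$. Comparison functions: $\mathcal{K}$ is the set of continuous strictly increasing $\mu:\mathbb{R}_+\to\mathbb{R}_+$ with $\mu(0)=0$; $\mathcal{K}_\infty$ is the set of unbounded $\mu\in\mathcal{K}$; $\mathcal{L}$ is the set of continuous strictly decreasing $\mu:\mathbb{R}_+\to\mathbb{R}_+$ with $\lim_{t\to\infty}\mu(t)=0$; $\mathcal{KL}$ is the set of continuous $\kappa:\mathbb{R}_+\times\mathbb{R}_+\to\mathbb{R}_+$ with $\kappa(\cdot,t)\in\mathcal{K}$ for all $t\ge0$ and $\kappa(r,\cdot)\in\mathcal{L}$ for all $r>0$.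 A linear operator $A:D(A)\subset X\to X$ on a (complex) Hilbert space $X$ is diagonalizable if its resolvent set is nonempty and there is a Riesz basis $(\varphi_n)_{n\in\mathbb{N}}$ in $X$ consisting of eigenvectors of $A$. Let $\lambda_n$ be the eigenvalue of $\varphi_n$ and $(\psi_n)_{n\in\mathbb{N}}$ the biorthogonal sequence of $(\varphi_n)_{n\in\mathbb{N}}$. Then $Ax=\sum_n\lambda_n\langle x,\psi_n\rangle\varphi_n$ with $D(A)=\{x\in X:\sum_n|\lambda_n|^2|\langle x,\psi_n\rangle|^2<\infty\}$, and, when $\operatorname{Re}\lambda_n\le0$ for all $n$, the fractional power $(-A)^\alpha$ ($\alpha>0$) of the sectorial operator $-A$ has domain $D((-A)^\alpha)=\{x\in X:\sum_{n=1}^\infty|\lambda_n|^{2\alpha}|\langle x,\psi_n\rangle|^2<\infty\}$. A $C_0$-semigroup $(T(t))_{t\ge0}$ with generator $A$ is semi-uniformly stable if it is uniformly bounded and $\|T(t)(I-A)^{-1}\|\to0$ as $t\to\infty$ (it is known that then $\sigma(A)\cap i\mathbb{R}=\emptyset$, so $A^{-1}$ is a bounded operator). It is polynomially stable with parameter $\alpha>0$ if it is semi-uniformly stable and $\|T(t)A^{-1}\|=O(t^{-1/\alpha})$ as $t\to\infty$. The linear system $\Sigma_{\mathrm{lin}}(A,B)$ is $\dot x(t)=Ax(t)+Bu(t)$, $t\ge0$, $x(0)=x_0\in X$, with $u\in L^\infty(\mathbb{R}_+,U)$; its unique mild solution is $\phi(t,x_0,u)=T(t)x_0+\int_0^tT(t-s)Bu(s)\,\mathrm{d}s$.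 $\Sigma_{\mathrm{lin}}(A,B)$ is uniformly globally stable (UGS) for $\mathcal{U}=L^\infty(\mathbb{R}_+,U)$ if there exist $\gamma,\mu\in\mathcal{K}_\infty$ such that $\|\phi(t,x_0,u)\|\le\gamma(\|x_0\|)+\mu(\|u\|_\infty)$ for all $x_0\in X$, $u\in L^\infty(\mathbb{R}_+,U)$, $t\ge0$. It is polynomially input-to-state stable (polynomially ISS) with parameter $\alpha>0$ for $\mathcal{U}=L^\infty(\mathbb{R}_+,U)$ if it is UGS and there exist $\kappa\in\mathcal{KL}$ and $\mu\in\mathcal{K}_\infty$ such that $\|\phi(t,x_0,u)\|\le\kappa(\|x_0\|_A,t)+\mu(\|u\|_\infty)$ for all $x_0\in D(A)$, $u\in L^\infty(\mathbb{R}_+,U)$, $t\ge0$, and $\kappa(r,t)=O(t^{-1/\alpha})$ as $t\to\infty$ for every $r>0$. *)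

(* Defs.v *)
From HB Require Import structures.
From mathcomp Require Import all_boot all_order all_algebra.
From mathcomp Require Import complex.
From mathcomp Require Import all_classical all_reals all_analysis ess_sup_inf.

Set Implicit Arguments.
Unset Strict Implicit.
Unset Printing Implicit Defensive.

Import Order.TTheory GRing.Theory Num.Theory.
Import numFieldNormedType.Exports.

Local Open Scope classical_set_scope.
Local Open Scope complex_scope.
Local Open Scope ring_scope.

Section BigOAndComparison.
Context {R : realType}.

(* f takes extended real values so that it can be an operator norm; on the
   right a finite bound is required. *)
Definition bigO_pinfty (f : R -> \bar R) (g : R -> R) : Prop :=
  exists M t0 : R, 0 < M /\ forall t : R, t0 <= t -> (f t <= (M * g t)%:E)%E.

(* Comparison functions are functions on R of which only the restriction to
   [0, +oo) matters. *)
Definition classK (mu : R -> R) : Prop :=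
  [/\ {within `[0, +oo[, continuous mu},
      forall r : R, 0 <= r -> 0 <= mu r,
      forall r s : R, 0 <= r -> r < s -> mu r < mu s
    & mu 0 = 0].

Definition classKoo (mu : R -> R) : Prop :=
  classK mu /\ forall M : R, exists2 r : R, 0 <= r & M < mu r.

Definition classL (mu : R -> R) : Prop :=
  [/\ {within `[0, +oo[, continuous mu},
      forall r : R, 0 <= r -> 0 <= mu r,
      forall r s : R, 0 <= r -> r < s -> mu s < mu r
    & mu t @[t --> +oo] --> (0 : R)].

Definition classKL (kappa : R -> R -> R) : Prop :=
  [/\ {within [set p : R * R | 0 <= p.1 /\ 0 <= p.2],
         continuous (fun p : R * R => kappa p.1 p.2)},
      forall t : R, 0 <= t -> classK (fun r => kappa r t)
    & forall r : R, 0 < r -> classL (kappa r)].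

End BigOAndComparison.

(* The library norm of a normed Z-module over R[i] takes its values in R[i],
   where it is a nonnegative real; rnorm is the same number as an element of R. *)
Definition rnorm {R : realType} {E : normedZmodType R[i]} (x : E) : R :=
  complex.Re `|x|.

Section Bochner.
Context {R : realType} {E : normedModType R[i]}.
Local Notation mu := (@lebesgue_measure R).

(* A presentation \sum_i 1_(A_i) x_i of an E-valued simple function on R. *)
Record simple_fun := SimpleFun {
  sf_size : nat ;
  sf_set : 'I_sf_size -> set R ;
  sf_vec : 'I_sf_size -> E ;
  sf_measurable : forall i, measurable (sf_set i) ;
  sf_finite : forall i, (mu (sf_set i) < +oo)%E }.

Definition simple_eval (s : simple_fun) (t : R) : E :=
  \sum_(i < sf_size s) (\1_(sf_set i) t : R)%:C *: sf_vec i.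

Definition simple_integral (D : set R) (s : simple_fun) : E :=
  \sum_(i < sf_size s) (fine (mu (sf_set i `&` D)))%:C *: sf_vec i.

Definition ae_cvg_simple (D : set R) (s : nat -> simple_fun) (f : R -> E) :=
  {ae mu, forall t : R, D t -> simple_eval (s n) t @[n --> \oo] --> f t}.

Definition strongly_measurable (D : set R) (f : R -> E) : Prop :=
  exists s : nat -> simple_fun, ae_cvg_simple D s f.

Definition is_bochner_integral (D : set R) (f : R -> E) (v : E) : Prop :=
  exists s : nat -> simple_fun,
    [/\ ae_cvg_simple D s f,
        (\int[mu]_(t in D) (rnorm (f t - simple_eval (s n) t))%:E)%E
          @[n --> \oo] --> 0%E
      & simple_integral D (s n) @[n --> \oo] --> v].

(* The default 0 is only taken when f is not Bochner integrable over D, which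
   does not happen for the integrand of the mild solution below. *)
Definition bochner_integral (D : set R) (f : R -> E) : E :=
  xget 0 [set v | is_bochner_integral D f v].

(* The extension of the norm of u by 0 to the negative half-line does not change
   the essential supremum over [0, +oo). *)
Definition ess_norm (u : R -> E) : \bar R :=
  ess_sup mu (fun t : R => (((fun s : R => rnorm (u s)) \_ `[0, +oo[) t)%:E).

Definition Linfty (u : R -> E) : Prop :=
  strongly_measurable `[0, +oo[ u /\ (ess_norm u < +oo)%E.

Definition norm_Linfty (u : R -> E) : R := fine (ess_norm u).

End Bochner.
Arguments simple_fun {R} E.

Section Operators.
Context {R : realType} {X : normedModType R[i]}.

(* ofun is only meaningful on odom. *)
Record unbounded_op := UnboundedOp { odom : set X ; ofun :> X -> X }.

Implicit Types (A : unbounded_op) (T : R -> X -> X).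

Definition linear_op A : Prop :=
  odom A 0 /\
  forall (a : R[i]) x y, odom A x -> odom A y ->
    odom A (a *: x + y) /\ A (a *: x + y) = a *: A x + A y.

Definition scalar_minus (lam : R[i]) A : unbounded_op :=
  UnboundedOp (odom A) (fun x => lam *: x - A x).

Definition is_bounded_inverse A (S : X -> X) : Prop :=
  [/\ linear S, continuous S,
      forall x, odom A (S x) /\ A (S x) = x
    & forall x, odom A x -> S (A x) = x].

Definition resolvent_set A : set R[i] :=
  [set lam | exists S, is_bounded_inverse (scalar_minus lam A) S].

Definition graph_norm A (x : X) : R := rnorm x + rnorm (A x).

Definition opnorm (L : X -> X) : \bar R :=
  ereal_sup [set (rnorm (L x))%:E | x in [set x | rnorm x <= 1]].

Definition C0_semigroup T : Prop :=
  [/\ forall t : R, 0 <= t -> linear (T t) /\ continuous (T t),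
      forall x, T 0 x = x,
      forall (s t : R) (x : X), 0 <= s -> 0 <= t -> T (s + t) x = T s (T t x)
    & forall x, T t x @[t --> 0^'+] --> x].

Definition is_generator A T : Prop :=
  let quot x (h : R) := (h^-1)%:C *: (T h x - x) in
  odom A = [set x | exists y : X, quot x h @[h --> 0^'+] --> y] /\
  forall x, odom A x -> quot x h @[h --> 0^'+] --> A x.

Definition semi_uniformly_stable A T : Prop :=
  (exists M : R, forall (t : R) (x : X), 0 <= t -> rnorm (T t x) <= M * rnorm x) /\
  exists S, is_bounded_inverse (scalar_minus 1 A) S /\
    opnorm (fun x => T t (S x)) @[t --> +oo] --> 0%E.

Definition polynomially_stable A T (alpha : R) : Prop :=
  semi_uniformly_stable A T /\
  exists S, is_bounded_inverse A S /\
    bigO_pinfty (fun t => opnorm (fun x => T t (S x)))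
                (fun t => t `^ (- alpha^-1)).

End Operators.
Arguments unbounded_op {R} X.

Section Diagonalizable.
Context {R : realType} {X : normedModType R[i]}.
Variable ip : X -> X -> R[i].
Implicit Types (A : unbounded_op X) (phi psi : nat -> X) (lam : nat -> R[i]).

Definition riesz_basis phi : Prop :=
  dense [set x | exists (N : nat) (a : nat -> R[i]),
                   x = \sum_(n < N) a n *: phi n] /\
  exists m M : R, [/\ 0 < m, 0 < M
    & forall (N : nat) (a : nat -> R[i]),
        m * \sum_(n < N) rnorm (a n) ^+ 2
          <= rnorm (\sum_(n < N) a n *: phi n) ^+ 2
          <= M * \sum_(n < N) rnorm (a n) ^+ 2].

Definition biorthogonal phi psi : Prop :=
  forall n m, ip (phi n) (psi m) = (n == m)%:R.

Definition riesz_eigenbasis A phi lam : Prop :=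
  riesz_basis phi /\ forall n, odom A (phi n) /\ A (phi n) = lam n *: phi n.

Definition diagonalizable_op A : Prop :=
  [/\ linear_op A, resolvent_set A !=set0
    & exists phi lam, riesz_eigenbasis A phi lam].

(* The domain of (-A)^alpha for a diagonalizable A whose eigenvalues satisfy
   Re lam_n <= 0, by the spectral description of the fractional power; the set
   does not depend on the chosen basis of eigenvectors. *)
Definition dom_fractional_power A (alpha : R) : set X :=
  [set x | exists phi lam psi,
     [/\ riesz_eigenbasis A phi lam, biorthogonal phi psi
       & (\sum_(0 <= n <oo) (rnorm (lam n) `^ (2 * alpha)
             * rnorm (ip x (psi n)) ^+ 2)%:E < +oo)%E]].

End Diagonalizable.

Section LinearSystem.
Context {R : realType} {U X : normedModType R[i]}.
Implicit Types (A : unbounded_op X) (T : R -> X -> X) (B : U -> X).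

Definition finite_rank B : Prop :=
  exists (n : nat) (b : 'I_n -> X),
    forall u, exists c : 'I_n -> R[i], B u = \sum_(i < n) c i *: b i.

Definition mild_solution T B (t : R) (x0 : X) (u : R -> U) : X :=
  T t x0 + bochner_integral `[0, t] (fun s => T (t - s) (B (u s))).

Definition uniformly_globally_stable T B : Prop :=
  exists gamma mu : R -> R, [/\ classKoo gamma, classKoo mu
    & forall (x0 : X) (u : R -> U) (t : R), Linfty u -> 0 <= t ->
        rnorm (mild_solution T B t x0 u)
          <= gamma (rnorm x0) + mu (norm_Linfty u)].

Definition polynomially_ISS A T B (alpha : R) : Prop :=
  uniformly_globally_stable T B /\
  exists (kappa : R -> R -> R) (mu : R -> R),
    [/\ classKL kappa, classKoo mu,
        forall (x0 : X) (u : R -> U) (t : R), odom A x0 -> Linfty u -> 0 <= t ->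
          rnorm (mild_solution T B t x0 u)
            <= kappa (graph_norm A x0) t + mu (norm_Linfty u)
      & forall r : R, 0 < r ->
          bigO_pinfty (fun t => (kappa r t)%:E) (fun t => t `^ (- alpha^-1))].

End LinearSystem.

(* Main.v *)
Require Import Defs.
From HB Require Import structures.
From mathcomp Require Import all_boot all_order all_algebra.
From mathcomp Require Import complex.
From mathcomp Require Import all_classical all_reals all_analysis.
From mathcomp Require Import measurable_realfun ess_sup_inf.
From mathcomp Require Import ring lra.

Set Implicit Arguments.
Unset Strict Implicit.
Unset Printing Implicit Defensive.

Import Order.TTheory GRing.Theory Num.Theory.
Import numFieldNormedType.Exports.

Local Open Scope classical_set_scope.
Local Open Scope complex_scope.
Local Open Scope ring_scope.

(** Write [v] for the contribution of the input to the state at time [t], the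
    integral over [0 <= s <= t] of [T(t-s) B u(s)].  The theorem comes down to
    bounding [v] by a multiple of the supremum norm of [u] that does not depend on
    [t]; the contribution [T(t) x0] of the initial state equals
    [T(t) A^-1 (A x0)] on the domain of [A] and decays by hypothesis
    ([domain_decay]).

    The squared norm of [v] is the integral of [Re <T(t-s) B u(s), v>]
    ([functional_bochner_le]).  As [B] has finite rank, [B u(s)] is a combination
    of finitely many unit vectors [y] in the range of [B], with coefficients at
    most [|B| |u(s)|] ([orthonormal_expansion]).  Hence it is enough that for every
    [y] in the domain of the fractional power the integral of [|<T(r) y, v>|] over
    [r >= 0] is at most a constant times the norm of [v]
    ([fractional_domain_orbit_bound], [convolution_bound]).

    Expand such a [y] in a Riesz basis of eigenvectors [phi_n] with coefficients
    [y_n].  The semigroup multiplies [phi_n] by [exp(lam_n r)]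
    ([semigroup_eigenvector]), so that integral is at most the sum of
    [|y_n| |<phi_n, v>| / |Re lam_n|].  Polynomial decay on the eigenvectors forces
    [1 / |Re lam_n| <= K |lam_n|^alpha] ([spectral_gap]); the sequence
    [|lam_n|^alpha |y_n|] is square summable because [y] lies in the domain of the
    fractional power, and so is [<phi_n, v>], with sum of squares at most a constant
    times [|v|^2], by Bessel's inequality for Riesz bases ([riesz_bessel]).  The
    Cauchy-Schwarz inequality, in the form of the arithmetic-geometric mean
    inequality, concludes ([orbit_integral_bound]).

    Testing against [v], rather than estimating the coordinates of [v] in a fixed
    basis, lets each vector [y] come with an eigenbasis of its own. *)

(** * The real-valued norm *)

Section RealNorm.
Context {R : realType}.

Lemma gtr0c (r : R) : (0 < r%:C) = (0 < r).
Proof. by rewrite -ltcR. Qed.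

Lemma rnormE (E : normedZmodType R[i]) (x : E) : `|x| = (rnorm x)%:C.
Proof. by rewrite /rnorm RRe_real// normr_real. Qed.

Lemma rnorm_ge0 (E : normedZmodType R[i]) (x : E) : 0 <= rnorm x.
Proof. by rewrite -ler0c -rnormE. Qed.

Lemma rnorm0 (E : normedZmodType R[i]) : rnorm (0 : E) = 0.
Proof. by rewrite /rnorm normr0. Qed.

Lemma rnorm0_eq0 (E : normedZmodType R[i]) (x : E) : rnorm x = 0 -> x = 0.
Proof. by move=> h; apply/normr0_eq0; rewrite rnormE h. Qed.

Lemma rnorm_gt0 (E : normedZmodType R[i]) (x : E) : (0 < rnorm x) = (x != 0).
Proof. by rewrite -normr_gt0 rnormE gtr0c. Qed.

Lemma rnormN (E : normedZmodType R[i]) (x : E) : rnorm (- x) = rnorm x.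
Proof. by rewrite /rnorm normrN. Qed.

Lemma rdistC (E : normedZmodType R[i]) (x y : E) : rnorm (x - y) = rnorm (y - x).
Proof. by rewrite /rnorm distrC. Qed.

Lemma ler_rnormD (E : normedZmodType R[i]) (x y : E) :
  rnorm (x + y) <= rnorm x + rnorm y.
Proof. by rewrite -lecR rmorphD /= -!rnormE ler_normD. Qed.

Lemma ler_rnorm_sum (E : normedZmodType R[i]) I (r : seq I) (P : pred I) (F : I -> E) :
  rnorm (\sum_(i <- r | P i) F i) <= \sum_(i <- r | P i) rnorm (F i).
Proof.
elim/big_ind2 : _ => [|x a y b xa yb|//]; first by rewrite rnorm0.
exact: le_trans (ler_rnormD _ _) (lerD xa yb).
Qed.

Lemma rnormZ (E : normedModType R[i]) (a : R[i]) (x : E) :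
  rnorm (a *: x) = rnorm a * rnorm x.
Proof. by apply: complexI; rewrite -rnormE normrZ !rnormE rmorphM. Qed.

Lemma rnormM (a b : R[i]) : rnorm (a * b) = rnorm a * rnorm b.
Proof. by apply: complexI; rewrite -rnormE normrM !rnormE rmorphM. Qed.

Lemma rnormC (r : R) : rnorm r%:C = `|r|.
Proof. by rewrite /rnorm normc_def/= expr0n addr0 sqrtr_sqr. Qed.

Lemma rnormV (a : R[i]) : rnorm a^-1 = (rnorm a)^-1.
Proof. by apply: complexI; rewrite -rnormE normfV rnormE fmorphV. Qed.

Lemma rnorm_conj (a : R[i]) : rnorm (Num.conj a) = rnorm a.
Proof. by rewrite /rnorm norm_conjC. Qed.

Lemma sqr_rnorm (a : R[i]) : a * Num.conj a = (rnorm a ^+ 2)%:C.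
Proof. by rewrite -normCK rnormE rmorphXn. Qed.

Lemma normr_Re_le (a : R[i]) : `|complex.Re a| <= rnorm a.
Proof. by rewrite -lecR -rnormE normc_ge_Re. Qed.

Lemma Re_le_rnorm (a : R[i]) : complex.Re a <= rnorm a.
Proof. exact: le_trans (ler_norm _) (normr_Re_le a). Qed.

Lemma rnorm_le_ReIm (a : R[i]) :
  rnorm a <= `|complex.Re a| + `|complex.Im a|.
Proof.
rewrite {1}(complexE a) (le_trans (ler_rnormD _ _))// rnormM !rnormC.
by rewrite [rnorm 'i]/rnorm normc_def/= expr0n expr1n add0r sqrtr1 mul1r.
Qed.

Lemma ReD (a b : R[i]) : complex.Re (a + b) = complex.Re a + complex.Re b.
Proof. by case: a; case: b. Qed.

Lemma ReZ (r : R) (a : R[i]) : complex.Re (r%:C * a) = r * complex.Re a.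
Proof. by case: a => u v /=; rewrite mul0r subr0. Qed.

Lemma cvg_rnormP (E : normedModType R[i]) (I : Type) (F : set_system I)
    (FF : Filter F) (f : I -> E) (l : E) :
  (f x @[x --> F] --> l) <->
  forall e : R, 0 < e -> \forall x \near F, rnorm (l - f x) < e.
Proof.
split => [/cvgrPdist_lt h e e0|h].
  have e0' : 0 < e%:C by rewrite gtr0c.
  by apply: filterS (h _ e0') => x; rewrite rnormE ltcR.
apply/cvgrPdist_lt => e e0.
have er : e = (complex.Re e)%:C by rewrite RRe_real// gtr0_real.
have e0' : 0 < complex.Re e by rewrite -gtr0c -er.
by apply: filterS (h _ e0') => x; rewrite -ltcR -rnormE -er.
Qed.

(** Linearity is a property here because the inverse of an unbounded operator comes
    as a bare function. *)
Lemma linear_continuous_rbounded (V W : normedModType R[i]) (f : V -> W) :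
  linear f -> continuous f ->
  exists2 C : R, 0 < C & forall x, rnorm (f x) <= C * rnorm x.
Proof.
move=> lf cf.
pose Lf := GRing.isLinear.Build _ _ _ _ f lf.
pose g : {linear V -> W} := HB.pack f Lf.
have /linear_boundedP : bounded_near g (nbhs 0).
  by apply/linear_bounded_continuous; exact: cf.
move=> [M [Mreal /(_ (`|M| + 1))]].
have M1 : M < `|M| + 1.
  by rewrite (le_lt_trans (real_ler_norm Mreal))// ltrDl.
move=> /(_ M1) h.
exists (rnorm M + 1) => [|x]; first by rewrite ltr_wpDl ?rnorm_ge0.
by rewrite -lecR rmorphM rmorphD rmorph1 /= -!rnormE; exact: h.
Qed.

End RealNorm.

(** * Bounding a Bochner integral through a real functional *)

(** The integral of a nonnegative function is the supremum of the integrals of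
    the simple functions below it, so it is monotone even when the larger function
    is not measurable.  This matters because the functions integrated in a Bochner
    integral are limits almost everywhere of measurable functions, hence need not
    be Borel measurable. *)
Lemma ge0_le_lower_integral d (T : measurableType d) (R : realType)
    (mu : {measure set T -> \bar R}) (D N : set T) (f1 f2 : T -> \bar R) :
  measurable D -> measurable N -> mu N = 0%E -> measurable_fun D f1 ->
  (forall x, D x -> (0 <= f1 x)%E) -> (forall x, (0 <= f2 x)%E) ->
  (forall x, D x -> ~ N x -> (f1 x <= f2 x)%E) ->
  (\int[mu]_(x in D) f1 x <= \int[mu]_(x in D) f2 x)%E.
Proof.
move=> mD mN N0 mf1 f10 f20 f12.
rewrite (ge0_negligible_integral mN)// integral_mkcond [leRHS]integral_mkcond.
rewrite !ge0_integralTE//; last 2 first.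
- by move=> x; rewrite patchE; case: ifPn.
- by move=> x; rewrite patchE; case: ifPn => // /set_mem[Dx _]; exact: f10.
apply: le_ereal_sup => _ [h hf1 <-]; exists h => // x.
apply: (le_trans (hf1 x)); rewrite !patchE.
case: ifPn => [|_]; last by case: ifPn => [xD|_]; [exact: f20|].
by rewrite inE => -[Dx Nx]; rewrite mem_set//; exact: f12.
Qed.

Section BochnerBound.
Context {R : realType}.
Local Notation mu := (@lebesgue_measure R).
Variable E : normedModType R[i].

Section functional.
Variable L : E -> R.
Hypothesis LD : {morph L : x y / x + y}.
Hypothesis LZ : forall r x, L (r%:C *: x) = r * L x.

Let L0 : L 0 = 0. Proof. by rewrite -(scale0r 0) LZ mul0r. Qed.

Lemma functional_sum n (F : 'I_n -> E) : L (\sum_(i < n) F i) = \sum_(i < n) L (F i).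
Proof. by elim/big_ind2 : _ => [//|x a y b <- <-|//]; rewrite LD. Qed.

Let mu_simple_lty (D : set (measurableTypeR R)) (s : simple_fun E)
    (i : 'I_(sf_size s)) :
  measurable D -> (mu (sf_set i `&` D) < +oo)%E.
Proof.
move=> mD; apply: (le_lt_trans _ (sf_finite i)); have mA := sf_measurable i.
by apply: le_measure; rewrite ?inE//; exact: measurableI.
Qed.

Let integrable_indic_simple (D : set (measurableTypeR R)) (s : simple_fun E)
    (i : 'I_(sf_size s)) :
  measurable D -> mu.-integrable D (fun t => (\1_(sf_set i) t)%:E).
Proof.
move=> mD; have mA := sf_measurable i.
apply/integrableP; split; first exact/measurable_EFinP/measurable_indic.
under eq_integral do rewrite gee0_abs ?lee_fin//.
by rewrite integral_indic// mu_simple_lty.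
Qed.

Let integrable_simple (D : set (measurableTypeR R)) (s : simple_fun E)
    (i : 'I_(sf_size s)) : measurable D ->
  mu.-integrable D (fun t => (L (sf_vec i) * \1_(sf_set i) t)%:E).
Proof.
move=> mD.
rewrite (_ : (fun _ => _) = (fun t => (L (sf_vec i))%:E * (\1_(sf_set i) t)%:E)%E)//.
by apply: integrableZl => //; exact: integrable_indic_simple.
Qed.

Lemma integrable_simple_eval (D : set (measurableTypeR R)) (s : simple_fun E) :
  measurable D ->
  mu.-integrable D (fun t => (L (simple_eval s t))%:E).
Proof.
move=> mD.
rewrite (_ : (fun _ => _) =
    fun t => (\sum_(i < sf_size s) (L (sf_vec i) * \1_(sf_set i) t)%:E)%E).
  by apply: integrable_sum => // i _; exact: integrable_simple.
apply/funext => t; rewrite sumEFin functional_sum.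
by congr (_%:E); apply: eq_bigr => i _; rewrite LZ mulrC.
Qed.

Lemma functional_simple_integral (D : set (measurableTypeR R)) (s : simple_fun E) :
  measurable D ->
  (L (simple_integral D s))%:E = (\int[mu]_(t in D) (L (simple_eval s t))%:E)%E.
Proof.
move=> mD.
transitivity (\int[mu]_(t in D)
    (\sum_(i < sf_size s) (L (sf_vec i) * \1_(sf_set i) t)%:E))%E.
  rewrite integral_sum//; last by move=> i; exact: integrable_simple.
  rewrite functional_sum -sumEFin; apply: eq_bigr => i _.
  have mA := sf_measurable i.
  under eq_integral do rewrite EFinM.
  rewrite integralZl//; last exact: integrable_indic_simple.
  rewrite integral_indic// LZ mulrC EFinM fineK// ge0_fin_numE//.
  exact: mu_simple_lty.
apply: eq_integral => t _; rewrite sumEFin functional_sum.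
by congr (_%:E); apply: eq_bigr => i _; rewrite LZ mulrC.
Qed.

(** Against simple functions [s n] the functional [L] commutes with the integral,
    and the excess of [L (s n)] over [g] is at most [C] times the distance from
    [f] to [s n], whose integral tends to zero. *)
Lemma functional_bochner_le (C : R) (D : set (measurableTypeR R)) (f : R -> E)
    (g : R -> R) (v : E) :
  0 < C -> (forall x, L x <= C * rnorm x) ->
  measurable D -> mu.-integrable D (EFin \o g) ->
  {ae mu, forall t, D t -> L (f t) <= g t} ->
  is_bochner_integral D f v ->
  ((L v)%:E <= \int[mu]_(t in D) (g t)%:E)%E.
Proof.
move=> C0 LC mD ig [N [mN N0 DN]] [s [_ sf sv]].
(* the positive part of the excess, scaled so that it lies below the distance *)
pose h n t := C^-1 * Num.max (L (simple_eval (s n) t) - g t) 0.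
have ih n : mu.-integrable D (fun t => (L (simple_eval (s n) t) - g t)%:E).
  exact: (integrableB mD (integrable_simple_eval (s n) mD) ig).
have mh n : measurable_fun D (fun t => (h n t)%:E).
  apply/measurable_EFinP; apply: measurable_funM => //.
  apply: measurable_maxr => //.
  by apply/measurable_EFinP; exact: (measurable_int mu (ih n)).
have hle n : (\int[mu]_(t in D) (h n t)%:E <=
    \int[mu]_(t in D) (rnorm (f t - simple_eval (s n) t))%:E)%E.
  apply: (ge0_le_lower_integral mD mN) => // [x Dx|x|x Dx Nx].
  - by rewrite lee_fin mulr_ge0 ?invr_ge0 ?(ltW C0)// le_max lexx orbT.
  - by rewrite lee_fin rnorm_ge0.
  - rewrite lee_fin /h ler_pdivrMl// ge_max mulr_ge0 ?rnorm_ge0 ?(ltW C0)//.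
    have fg : L (f x) <= g x by apply: contrapT => nfg; apply/Nx/DN => /(_ Dx).
    rewrite andbT rdistC (le_trans _ (LC _))//.
    have := LD (simple_eval (s n) x - f x) (f x); rewrite subrK => ->.
    by lra.
have key n : ((L (simple_integral D (s n)))%:E <=
    \int[mu]_(t in D) (g t)%:E + C%:E * \int[mu]_(t in D)
      (rnorm (f t - simple_eval (s n) t))%:E)%E.
  have -> : (L (simple_integral D (s n)))%:E =
      (\int[mu]_(t in D) (g t)%:E +
       \int[mu]_(t in D) (L (simple_eval (s n) t) - g t)%:E)%E.
    rewrite functional_simple_integral// -integralD//.
    by apply: eq_integral => t _; rewrite -EFinD addrC subrK.
  rewrite leeD2l// (le_trans _ (lee_wpmul2l _ (hle n))) ?lee_fin ?(ltW C0)//.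
  have hpos t : (C%:E * (h n t)%:E =
      (fun t => (L (simple_eval (s n) t) - g t)%:E)^\+ t)%E.
    by rewrite -EFinM /h mulrA divff ?gt_eqF// mul1r funeposE EFin_max.
  rewrite -ge0_integralZl_EFin ?(ltW C0)//; last first.
    by move=> x Dx; rewrite lee_fin mulr_ge0 ?invr_ge0 ?(ltW C0)// le_max lexx orbT.
  under [leRHS]eq_integral do rewrite hpos.
  apply: le_integral => //; first exact: integrable_funepos.
  by move=> t _; rewrite funeposE le_max lexx.
have gfin : (\int[mu]_(t in D) (g t)%:E)%E \is a fin_num.
  exact: integrable_fin_num ig.
rewrite -(fineK gfin) lee_fin.
suff H (e : R) : 0 < e -> L v <= fine (\int[mu]_(t in D) (g t)%:E)%E + e.
  by apply/ler_addgt0Pr => e; exact: H.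
move=> e0.
have e2 : 0 < e / 2 / C by rewrite !divr_gt0.
have {}sf : \forall n \near \oo, (\int[mu]_(t in D)
    (rnorm (f t - simple_eval (s n) t))%:E < (e / 2 / C)%:E)%E.
  apply: (sf [set y | y < (e / 2 / C)%:E]%E); apply: open_nbhs_nbhs; split.
    exact: open_ereal_lt_ereal.
  by rewrite /= lte_fin.
move/cvg_rnormP : sv => /(_ _ e2) sv.
near \oo => n.
have Jn : (\int[mu]_(t in D)
    (rnorm (f t - simple_eval (s n) t))%:E < (e / 2 / C)%:E)%E by near: n.
have wn : rnorm (v - simple_integral D (s n)) < e / 2 / C by near: n.
have := LD (v - simple_integral D (s n)) (simple_integral D (s n)).
rewrite subrK => ->.
have h1 : L (v - simple_integral D (s n)) <= e / 2.
  by rewrite (le_trans (LC _))// mulrC -ler_pdivlMr// ltW.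
have h2 : L (simple_integral D (s n)) <=
    fine (\int[mu]_(t in D) (g t)%:E)%E + e / 2.
  rewrite -lee_fin EFinD fineK// (le_trans (key n))// leeD2l//.
  rewrite (_ : e / 2 = C * (e / 2 / C)); last by rewrite [C * _]mulrC divfK ?gt_eqF.
  by rewrite EFinM lee_wpmul2l ?lee_fin ?(ltW C0)// ltW.
by move: h1 h2; lra.
Unshelve. all: by end_near. Qed.

End functional.
End BochnerBound.

(** * Inner products and Riesz bases *)

Section Hilbert.
Context {R : realType} {X : normedModType R[i]}.
Variable ip : {dot X for (@Num.conj R[i])}.
Hypothesis hilbert_norm : forall x : X, `|x| ^+ 2 = ip x x.

Lemma ip_self x : ip x x = (rnorm x ^+ 2)%:C.
Proof. by rewrite -hilbert_norm rnormE rmorphXn. Qed.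

Lemma ipDl x y z : ip (x + y) z = ip x z + ip y z.
Proof. exact: linearDl. Qed.

Lemma ipBl x y z : ip (x - y) z = ip x z - ip y z.
Proof. exact: linearBl. Qed.

Lemma ipZl a x z : ip (a *: x) z = a * ip x z.
Proof. exact: linearZl_LR. Qed.

Lemma ipBr x y z : ip x (y - z) = ip x y - ip x z.
Proof. exact: linearBr. Qed.

Lemma ipZr a x y : ip x (a *: y) = Num.conj a * ip x y.
Proof. exact: linearZr_LR. Qed.

Lemma ipC x y : ip x y = Num.conj (ip y x).
Proof. by rewrite hermC/= expr0 mul1r. Qed.

Lemma ip_suml I (r : seq I) (P : pred I) (F : I -> X) z :
  ip (\sum_(i <- r | P i) F i) z = \sum_(i <- r | P i) ip (F i) z.
Proof. exact: linear_sumlz. Qed.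

Lemma cauchy_schwarz x y : rnorm (ip x y) <= rnorm x * rnorm y.
Proof.
have [->|y0] := eqVneq y 0; first by rewrite linear0r !rnorm0 mulr0.
have ny : 0 < rnorm y by rewrite rnorm_gt0.
have : (0 <= (rnorm y ^+ 2 * rnorm x ^+ 2 - rnorm (ip x y) ^+ 2)%:C :> R[i]).
  have -> : (rnorm y ^+ 2 * rnorm x ^+ 2 - rnorm (ip x y) ^+ 2)%:C =
      (rnorm y ^+ 2)%:C * ip (x - (ip x y / ip y y) *: y) (x - (ip x y / ip y y) *: y).
    have yy : ip y y != 0 by rewrite ip_self gt_eqF// gtr0c exprn_gt0.
    rewrite ipBr ipZr !ipBl !ipZl divfK// subrr mulr0 subr0.
    rewrite rmorphB rmorphM/= -!ip_self -sqr_rnorm -ipC.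
    by field.
  by rewrite mulr_ge0 ?ip_self// lecR ?sqr_ge0.
rewrite lecR subr_ge0 -exprMn mulrC ler_pXn2r// ?nnegrE ?rnorm_ge0//.
by rewrite mulr_ge0 ?rnorm_ge0.
Qed.

(** Gram-Schmidt, for a subspace that is only known to lie in the span of
    finitely many vectors which may not belong to it: a unit vector [w] of [V]
    that uses the last vector is split off, and its complement in [V] lies in the
    span of the projections of the other vectors. *)
Lemma orthonormal_expansion n (V : set X) (b : 'I_n -> X) :
  V 0 -> (forall a x y, V x -> V y -> V (a *: x + y)) ->
  (forall x, V x -> exists c : 'I_n -> R[i], x = \sum_i c i *: b i) ->
  exists e : seq X, (forall y, y \in e -> V y /\ rnorm y = 1) /\
    forall x, V x -> x = \sum_(y <- e) ip x y *: y.
Proof.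
elim: n V b => [|n IH] V b V0 VD Vb.
  exists [::]; split => // x /Vb[c ->].
  by rewrite big_ord0 big_nil.
pose b' (i : 'I_n) := b (widen_ord (leqnSn n) i).
have [allV|] := pselect (forall x, V x ->
    exists c : 'I_n -> R[i], x = \sum_i c i *: b' i).
  exact: IH allV.
move=> /existsNP[v /not_implyP[Vv nv]].
have [c vE] := Vb v Vv.
pose d i := c (widen_ord (leqnSn n) i).
have vE' : v = \sum_i d i *: b' i + c ord_max *: b ord_max.
  by rewrite vE big_ord_recr.
have cm0 : c ord_max != 0.
  by apply/eqP => cm; apply: nv; exists d; rewrite vE' cm scale0r addr0.
have nv0 : 0 < rnorm v.
  rewrite rnorm_gt0; apply/eqP => v0; apply: nv; exists (fun=> 0).
  by rewrite v0 big1// => i _; rewrite scale0r.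
pose r := (rnorm v)%:C; have r0 : r != 0 by rewrite gt_eqF// gtr0c.
pose w := r^-1 *: v.
have Vw : V w by have := VD r^-1 v 0 Vv V0; rewrite addr0.
have nw : rnorm w = 1.
  by rewrite rnormZ rnormV rnormC ger0_norm ?rnorm_ge0// mulVf// gt_eqF.
have iw : ip w w = 1 by rewrite ip_self nw expr1n.
pose V' := [set x | V x /\ ip x w = 0].
pose p i := b' i - ip (b' i) w *: w.
have [|a x y [Vx xw] [Vy yw]|x [Vx xw]|e [eV eE]] := IH V' p.
- by split => //; rewrite linear0l.
- by split; [exact: VD|rewrite ipDl ipZl xw yw mulr0 addr0].
- have [a xE] := Vb x Vx.
  (* [k] is the coefficient of [w] once [b ord_max] is eliminated from [x] *)
  pose k := a ord_max / c ord_max * r.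
  pose f i := a (widen_ord (leqnSn n) i) - a ord_max / c ord_max * d i.
  have xE' : x = \sum_i f i *: b' i + k *: w.
    rewrite /w scalerA /k mulfK// vE' scalerDr scalerA divfK//.
    rewrite addrA {1}xE big_ord_recr/=; congr (_ + _).
    rewrite scaler_sumr -big_split/=; apply: eq_bigr => i _.
    by rewrite /f scalerA scalerBl subrK.
  exists f.
  have -> : \sum_i f i *: p i =
      \sum_i f i *: b' i - ip (\sum_i f i *: b' i) w *: w.
    rewrite ip_suml scaler_suml -sumrB; apply: eq_bigr => i _.
    by rewrite ipZl scalerBr scalerA.
  have -> : \sum_i f i *: b' i = x - k *: w by rewrite xE' addrK.
  by rewrite ipBl xw ipZl iw mulr1 sub0r scaleNr opprK subrK.
exists (w :: e); split => [y|x Vx].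
  by rewrite inE => /predU1P[->//|/eV[[]]].
rewrite big_cons.
have Vx' : V' (x - ip x w *: w).
  split; last by rewrite ipBl ipZl iw mulr1 subrr.
  by have := VD (- ip x w) w x Vw Vx; rewrite addrC scaleNr.
have /eqP := eE _ Vx'; rewrite subr_eq addrC => /eqP {1}->.
congr (_ + _); apply: eq_big_seq => y /eV[[_ yw] _].
by rewrite ipBl ipZl [ip w y]ipC yw rmorph0 mulr0 subr0.
Qed.

End Hilbert.

Section RieszBasis.
Context {R : realType} {X : normedModType R[i]}.
Variable ip : {dot X for (@Num.conj R[i])}.
Hypothesis hilbert_norm : forall x : X, `|x| ^+ 2 = ip x x.
Variables (phi psi : nat -> X).

(** Testing [y] against the combination of the [phi n] with coefficients
    [ip y (phi n)] gives the sum of their squares, and the upper Riesz inequality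
    bounds the norm of that combination. *)
Lemma riesz_bessel (M : R) :
  (forall N (a : nat -> R[i]), rnorm (\sum_(n < N) a n *: phi n) ^+ 2
     <= M * \sum_(n < N) rnorm (a n) ^+ 2) ->
  0 < M ->
  forall N y, \sum_(n < N) rnorm (ip (phi n) y) ^+ 2 <= M * rnorm y ^+ 2.
Proof.
move=> hM M0 N y.
set S := \sum_(n < N) _.
have S0 : 0 <= S by apply: sumr_ge0 => n _; rewrite sqr_ge0.
pose z := \sum_(n < N) ip y (phi n) *: phi n.
have zy : ip z y = S%:C.
  rewrite ip_suml rmorph_sum; apply: eq_bigr => n _ /=.
  by rewrite ipZl ipC mulrC sqr_rnorm.
have zS : rnorm z ^+ 2 <= M * S.
  have := hM N (fun n => ip y (phi n)); congr (_ <= _ * _).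
  by apply: eq_bigr => n _; rewrite ipC rnorm_conj.
have SS : S <= rnorm z * rnorm y.
  have := cauchy_schwarz hilbert_norm z y.
  by rewrite zy rnormC ger0_norm.
have [->|Sn0] := eqVneq S 0; first by rewrite mulr_ge0 ?(ltW M0) ?sqr_ge0.
have Sp : 0 < S by rewrite lt_neqAle eq_sym Sn0.
rewrite -(ler_pM2l Sp).
have : S ^+ 2 <= rnorm z ^+ 2 * rnorm y ^+ 2.
  by rewrite -exprMn ler_pXn2r// nnegrE mulr_ge0 ?rnorm_ge0.
rewrite -expr2 => /le_trans; apply.
by rewrite [leRHS]mulrCA [leRHS]mulrA ler_wpM2r ?sqr_ge0.
Qed.

Hypothesis basis : riesz_basis phi.
Hypothesis bio : biorthogonal ip phi psi.

Definition partial_expansion N (x : X) : X := \sum_(n < N) ip x (psi n) *: phi n.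

Let SN := partial_expansion.

Lemma partial_expansionD N x y : SN N (x + y) = SN N x + SN N y.
Proof.
by rewrite -big_split; apply: eq_bigr => n _ /=; rewrite ipDl scalerDl.
Qed.

Lemma partial_expansion_span N K (a : nat -> R[i]) : (K <= N)%N ->
  SN N (\sum_(n < K) a n *: phi n) = \sum_(n < K) a n *: phi n.
Proof.
move=> KN; rewrite /SN /partial_expansion.
transitivity (\sum_(n < N) \sum_(k < K) (a k * (k == n :> nat)%:R) *: phi n).
  apply: eq_bigr => n _; rewrite ip_suml -scaler_suml; congr (_ *: _).
  by apply: eq_bigr => k _; rewrite ipZl bio.
rewrite exchange_big; apply: eq_bigr => k _ /=.
rewrite (bigD1 (widen_ord KN k))//= eqxx mulr1 big1 ?addr0// => n nk.
rewrite (_ : (k == n :> nat) = false) ?mulr0 ?scale0r//.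
by apply/negbTE; apply: contra nk => /eqP kn; apply/eqP/val_inj.
Qed.

Let span_approx x (e : R) : 0 < e ->
  exists K (a : nat -> R[i]), rnorm (x - \sum_(n < K) a n *: phi n) < e.
Proof.
move=> e0; have e0' : 0 < e%:C by rewrite gtr0c.
have [] := basis.1 (ball x e%:C).
- by exists x; exact: ballxx.
- exact: ball_open.
- move=> y [+ [K [a ya]]]; rewrite -ball_normE /ball_/= rnormE ltcR ya => h.
  by exists K, a.
Qed.

(** On finite combinations of the [phi n] the two Riesz inequalities bound the
    partial expansions by the root of the quotient of their constants.  The bound
    [D] below depends on [N]; it serves only to pass from the dense set of finite
    combinations to the whole space. *)
Lemma partial_expansion_bounded :
  exists2 C : R, 0 < C & forall N x, rnorm (SN N x) <= C * rnorm x.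
Proof.
have [m [M [m0 M0 hmM]]] := basis.2.
pose C : R := Num.sqrt (M / m).
have C0 : 0 < C by rewrite sqrtr_gt0 divr_gt0.
have spanC N K (a : nat -> R[i]) : let y := \sum_(n < K) a n *: phi n in
    rnorm (SN N y) <= C * rnorm y.
  move=> y.
  have yE : y = \sum_(n < maxn N K) ip y (psi n) *: phi n.
    by symmetry; apply: partial_expansion_span; rewrite leq_maxr.
  rewrite -(@ler_pXn2r _ 2)// ?nnegrE ?mulr_ge0 ?rnorm_ge0 ?(ltW C0)//.
  have /andP[_ h1] := hmM N (fun n => ip y (psi n)).
  apply: (le_trans h1).
  have /andP[h2 _] := hmM (maxn N K) (fun n => ip y (psi n)).
  rewrite -yE in h2.
  rewrite exprMn sqr_sqrtr ?divr_ge0 ?(ltW M0) ?(ltW m0)// -mulrA ler_pM2l//.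
  rewrite ler_pdivlMl// (le_trans _ h2)// ler_pM2l//.
  rewrite -!(big_mkord xpredT (fun n => rnorm (ip y (psi n)) ^+ 2)).
  rewrite [leRHS](big_cat_nat (leq0n N) (leq_maxl N K))//= lerDl.
  by apply: sumr_ge0 => n _; rewrite sqr_ge0.
exists C => // N x.
pose D := \sum_(n < N) rnorm (psi n) * rnorm (phi n).
have D0 : 0 <= D by apply: sumr_ge0 => n _; rewrite mulr_ge0 ?rnorm_ge0.
have SD z : rnorm (SN N z) <= D * rnorm z.
  rewrite (le_trans (ler_rnorm_sum _ _ _))// mulr_suml ler_sum// => n _.
  rewrite rnormZ mulrAC ler_wpM2r ?rnorm_ge0// mulrC.
  exact: cauchy_schwarz.
suff H (e : R) : 0 < e -> rnorm (SN N x) <= C * rnorm x + e.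
  by apply/ler_addgt0Pr => e; exact: H.
move=> e0; have e1 : 0 < e / (C + D + 1).
  by rewrite divr_gt0// ltr_wpDl// addr_ge0// ltW.
have [K [a]] := span_approx x e1; set y := \sum_(n < K) _ => xy.
have xE : x = (x - y) + y by rewrite subrK.
have h1 : rnorm (SN N x) <= D * rnorm (x - y) + C * rnorm y.
  rewrite {1}xE partial_expansionD (le_trans (ler_rnormD _ _))// lerD//.
  exact: spanC.
have h2 : rnorm y <= rnorm x + rnorm (x - y).
  by have := ler_rnormD x (y - x); rewrite addrC subrK rdistC.
have h3 : (C + D + 1) * rnorm (x - y) <= e.
  by rewrite mulrC -ler_pdivlMr ?ltW// ltr_wpDl// addr_ge0// ltW.
have h4 := rnorm_ge0 (x - y); have h5 := ler_wpM2l (ltW C0) h2.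
move: h1 h3 h5 h4; nra.
Qed.

(** The partial expansions are uniformly bounded and reproduce the finite
    combinations, which are dense. *)
Lemma partial_expansion_cvg x (e : R) : 0 < e ->
  exists N, rnorm (x - SN N x) < e.
Proof.
move=> e0; have [C C0 SC] := partial_expansion_bounded.
have e1 : 0 < e / (1 + C) by rewrite divr_gt0// addr_gt0.
have [K [a]] := span_approx x e1; set y := \sum_(n < K) _ => xy.
exists K.
have -> : x - SN K x = (x - y) + SN K (y - x).
  have yK : SN K y = y by exact: partial_expansion_span.
  have := partial_expansionD K (y - x) x; rewrite subrK [LHS]yK => /eqP.
  by rewrite -subr_eq => /eqP <-; rewrite addrA subrK.
apply: (le_lt_trans (ler_rnormD _ _)).
apply: (@le_lt_trans _ _ (rnorm (x - y) + C * rnorm (y - x))).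
  by rewrite lerD2l SC.
by rewrite rdistC -{1}[rnorm _]mul1r -mulrDl mulrC -ltr_pdivlMr ?addr_gt0// rdistC.
Qed.

End RieszBasis.

(** * The semigroup on eigenvectors *)

Section ScalarExponential.
Context {R : realType}.
Implicit Types (lam : R[i]) (s t h : R).

Definition cexp lam t : R[i] :=
  (expR (complex.Re lam * t) * cos (complex.Im lam * t)) +i*
  (expR (complex.Re lam * t) * sin (complex.Im lam * t)).

Lemma cexp0 lam : cexp lam 0 = 1.
Proof. by rewrite /cexp !mulr0 expR0 cos0 sin0 mulr1 mulr0. Qed.

Lemma cexpD lam s t : cexp lam (s + t) = cexp lam s * cexp lam t.
Proof.
rewrite /cexp !mulrDr expRD cosD sinD; apply/eqP.
by rewrite eq_complex /=; apply/andP; split; apply/eqP; ring.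
Qed.

Lemma rnorm_cexp lam t : rnorm (cexp lam t) = expR (complex.Re lam * t).
Proof.
rewrite /rnorm normc_def/= !exprMn -mulrDr cos2Dsin2 mulr1 sqrtr_sqr.
by rewrite ger0_norm// expR_ge0.
Qed.

Let is_derive_mull (c : R) : is_derive (0 : R) 1 ( *%R c) c.
Proof.
have := is_deriveZ c (is_derive_id (0 : R) 1).
by rewrite /GRing.scale/= mulr1.
Qed.

Let right_diffquot (f : R -> R) (d : R) : is_derive (0 : R) 1 f d ->
  h^-1 * (f h - f 0) @[h --> 0^'+] --> d.
Proof.
move=> [df dE]; rewrite -dE.
have : h^-1 *: ((f \o shift 0) (h *: 1) - f 0) @[h --> 0^'] --> 'D_1 f 0 by exact: df.
move=> /cvg_dnbhs_at_right; apply: cvg_trans; apply: near_eq_cvg; near=> h.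
by rewrite /= addr0 [h *: 1]mulr1.
Unshelve. all: by end_near. Qed.

Let ReIm_sub_affine (z lam : R[i]) h :
  complex.Re (z - (1 + h%:C * lam)) = complex.Re z - 1 - h * complex.Re lam /\
  complex.Im (z - (1 + h%:C * lam)) = complex.Im z - h * complex.Im lam.
Proof. by case: z => u v; case: lam => x y; split => /=; ring. Qed.

(** The derivative of [cexp lam] at [0] in the form of an error bound relative to
    [h], to be set against the action of the generator on an eigenvector. *)
Lemma cexp_diffquot lam (e : R) : 0 < e ->
  \forall h \near 0^'+, rnorm (cexp lam h - (1 + h%:C * lam)) <= e * h.
Proof.
move=> e0; set a := complex.Re lam; set b := complex.Im lam.
have dexp := is_derive1_comp (is_derive_expR (a * 0)) (is_derive_mull a).
have dcos := is_derive1_comp (is_derive_cos (b * 0)) (is_derive_mull b).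
have dsin := is_derive1_comp (is_derive_sin (b * 0)) (is_derive_mull b).
have := right_diffquot (is_deriveM dexp dcos).
have := right_diffquot (is_deriveM dexp dsin).
rewrite /= /GRing.mul_fun/= !mulr0 expR0 cos0 sin0 /GRing.scale/=.
rewrite !mul1r oppr0 !mul0r !addr0 !add0r.
have e2 : 0 < e / 2 by rewrite divr_gt0.
move=> /cvgrPdist_le /(_ _ e2) hs /cvgrPdist_le /(_ _ e2) hc.
have {}hs : \forall h \near 0^'+,
    `|b - h^-1 * (expR (a * h) * sin (b * h))| <= e / 2.
  apply: filterS hs => h; congr (`|_ - _ * _| <= _).
  change (expR (a * h) * sin (b * h) - expR (a * 0) * sin (b * 0) =
    expR (a * h) * sin (b * h)).
  by rewrite !mulr0 sin0 mulr0 subr0.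
have {}hc : \forall h \near 0^'+,
    `|a - h^-1 * (expR (a * h) * cos (b * h) - 1)| <= e / 2.
  apply: filterS hc => h; congr (`|_ - _ * _| <= _).
  change (expR (a * h) * cos (b * h) - expR (a * 0) * cos (b * 0) =
    expR (a * h) * cos (b * h) - 1).
  by rewrite !mulr0 cos0 expR0 mulr1.
near=> h.
have h0 : 0 < h by near: h; exact: nbhs_right_gt.
have scale_le (c F : R) : `|c - h^-1 * F| <= e / 2 -> `|F - h * c| <= e / 2 * h.
  move=> cF; have -> : F - h * c = - (h * (c - h^-1 * F)).
    by rewrite mulrBr mulrA divff ?gt_eqF// mul1r opprB.
  by rewrite normrN normrM gtr0_norm// mulrC ler_pM2r.
have Hs : `|b - h^-1 * (expR (a * h) * sin (b * h))| <= e / 2 by near: h.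
have Hc : `|a - h^-1 * (expR (a * h) * cos (b * h) - 1)| <= e / 2 by near: h.
move: (scale_le _ _ Hs) (scale_le _ _ Hc) => {}Hs {}Hc.
rewrite (le_trans (rnorm_le_ReIm _))//.
have [-> ->] := ReIm_sub_affine (cexp lam h) lam h.
by rewrite (le_trans (lerD Hc Hs))// -mulrDl -splitr.
Unshelve. all: by end_near. Qed.

End ScalarExponential.

Section Eigenvector.
Context {R : realType} {X : normedModType R[i]}.
Implicit Types t h : R.
Variables (T : R -> X -> X) (M : R).
Hypothesis semigroup : C0_semigroup T.
Hypothesis bounded : forall (t : R) (x : X), 0 <= t -> rnorm (T t x) <= M * rnorm x.
Hypothesis M1 : 1 <= M.

Let M0 : 0 < M. Proof. exact: lt_le_trans ltr01 M1. Qed.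

Let TD t a x y : 0 <= t -> T t (a *: x + y) = a *: T t x + T t y.
Proof. by move=> t0; have [/(_ t t0)[+ _] _ _ _] := semigroup; apply. Qed.

Lemma semigroupZ t a x : 0 <= t -> T t (a *: x) = a *: T t x.
Proof.
move=> t0; have T0 : T t 0 = 0.
  have := TD (-1) 0 0 t0; rewrite scaler0 addr0 scaleN1r addNr; exact.
by have := TD a x 0 t0; rewrite T0 !addr0.
Qed.

Lemma semigroupB t x y : 0 <= t -> T t (x - y) = T t x - T t y.
Proof.
move=> t0; have := TD (-1) y x t0.
by rewrite !scaleN1r addrC => ->; rewrite addrC.
Qed.

Lemma semigroup_sum t I (r : seq I) (F : I -> X) : 0 <= t ->
  T t (\sum_(i <- r) F i) = \sum_(i <- r) T t (F i).
Proof.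
move=> t0; elim: r => [|i r IH].
  by rewrite !big_nil -(scale0r 0) semigroupZ// !scale0r.
by rewrite !big_cons -{1}[F i]scale1r TD// scale1r IH.
Qed.

Variables (phi : X) (lam : R[i]).
Let E := cexp lam.

Let defect h := rnorm (T h phi - E h *: phi).

(** Comparing the two geometric sequences [T h ^ n] and [E h ^ n] term by term:
    the defect of one step is propagated by the bounded operators [T] on one side
    and by the scalars [E] on the other. *)
Let telescoping n h : 0 <= h ->
  rnorm (T (n%:R * h) phi - E (n%:R * h) *: phi) <=
    n%:R * (M * expR (`|complex.Re lam| * (n%:R * h)) * defect h).
Proof.
move=> h0; have [_ T0 TA _] := semigroup.
elim: n => [|n IH]; first by rewrite !mul0r T0 /E cexp0 scale1r subrr rnorm0.
set K := expR (`|complex.Re lam| * (n%:R * h)) in IH.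
pose a : R := `|complex.Re lam|; rewrite -/a.
have a0 : 0 <= a by exact: normr_ge0.
have nh0 : 0 <= n%:R * h by rewrite mulr_ge0.
have -> : n.+1%:R * h = n%:R * h + h by rewrite -natr1 mulrDl mul1r.
have -> : T (n%:R * h + h) phi - E (n%:R * h + h) *: phi =
    T (n%:R * h) (T h phi - E h *: phi) +
    E h *: (T (n%:R * h) phi - E (n%:R * h) *: phi).
  rewrite semigroupB// semigroupZ// -TA// scalerBr scalerA /E cexpD.
  by rewrite [cexp _ (_ * _) * _]mulrC addrA subrK.
rewrite (le_trans (ler_rnormD _ _))// rnormZ rnorm_cexp.
have K1 : 1 <= K by rewrite -expR0 ler_expR mulr_ge0.
have H1 : 1 <= expR (a * h) by rewrite -expR0 ler_expR mulr_ge0.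
have EH : expR (complex.Re lam * h) <= expR (a * h).
  by rewrite ler_expR ler_wpM2r// ler_norm.
rewrite mulrDr expRD -/K -natr1 [leRHS]mulrDl mul1r addrC.
have d0 : 0 <= defect h by exact: rnorm_ge0.
apply: lerD.
  apply: (@le_trans _ _ (expR (a * h) * (n%:R * (M * K * defect h)))).
    by apply: ler_pM; rewrite ?expR_ge0 ?rnorm_ge0.
  by rewrite le_eqVlt; apply/orP; left; apply/eqP; ring.
apply: (le_trans (bounded _ nh0)); rewrite -mulrA ler_pM2l// ler_peMl//.
by rewrite mulr_ege1.
Qed.

Hypothesis eigen :
  (h^-1)%:C *: (T h phi - phi) @[h --> 0^'+] --> lam *: phi.

Let defect_small (e : R) : 0 < e -> \forall h \near 0^'+, defect h <= e * h.
Proof.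
move=> e0.
have e1 : 0 < e / 2 by rewrite divr_gt0.
have e2 : 0 < e / 2 / (rnorm phi + 1) by rewrite divr_gt0// ltr_wpDl ?rnorm_ge0.
have hE := cexp_diffquot lam e2.
have /cvg_rnormP /(_ _ e1) hT := eigen.
near=> h.
have h0 : 0 < h by near: h; exact: nbhs_right_gt.
have HE : rnorm (cexp lam h - (1 + h%:C * lam)) <= e / 2 / (rnorm phi + 1) * h by near: h.
have HT : rnorm (lam *: phi - (h^-1)%:C *: (T h phi - phi)) < e / 2 by near: h.
rewrite /defect.
have -> : T h phi - E h *: phi =
   - (h%:C *: (lam *: phi - (h^-1)%:C *: (T h phi - phi))) -
   (cexp lam h - (1 + h%:C * lam)) *: phi.
  rewrite scalerBr [(h%:C) *: ((h^-1)%:C *: _)]scalerA -rmorphM divff ?gt_eqF// scale1r.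
  rewrite scalerBl scalerDl scale1r scalerA !opprB.
  by rewrite -[T h phi - phi - _]addrA -opprD addrA subrK.
rewrite (le_trans (ler_rnormD _ _))// !rnormN !rnormZ rnormC gtr0_norm//.
rewrite (splitr e) mulrDl lerD//; first by rewrite mulrC ler_pM2r// ltW.
apply: (le_trans (ler_wpM2r (rnorm_ge0 _) HE)).
rewrite mulrAC ler_pM2r// mulrAC ler_pdivrMr ?ltr_wpDl ?rnorm_ge0//.
by rewrite ler_pM2l// lerDl.
Unshelve. all: by end_near. Qed.

(** Only the right derivative at [0] of the orbit of [phi] is known.  Over [n] steps
    of length [t / n] the orbit and the exponential drift apart by at most [n] times
    a defect that is small relative to [t / n], which tends to zero as [n] grows. *)
Lemma semigroup_eigenvector t : 0 <= t -> T t phi = E t *: phi.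
Proof.
rewrite le_eqVlt => /predU1P[<-|t0].
  by have [_ T0 _ _] := semigroup; rewrite T0 /E cexp0 scale1r.
apply/eqP; rewrite -subr_eq0; apply/eqP/rnorm0_eq0/eqP.
rewrite eq_le rnorm_ge0 andbT.
suff H (e : R) : 0 < e -> rnorm (T t phi - E t *: phi) <= 0 + e.
  by apply/ler_addgt0Pr => e; exact: H.
move=> e0; rewrite add0r.
pose K := t * M * expR (`|complex.Re lam| * t).
have K0 : 0 < K by rewrite !mulr_gt0 ?expR_gt0.
have e1 : 0 < e / K by rewrite divr_gt0.
have [d /= d0 hd] := defect_small e1.
(* [n.+1] steps, short enough for the defect to be small relative to their length *)
have [n nd] : exists n, t / d < n.+1%:R by exists (Num.trunc (t / d)); exact: truncnS_gt.
have n0 : (0 < n.+1%:R :> R) by rewrite ltr0n.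
have tn0 : 0 < t / n.+1%:R by rewrite divr_gt0.
have tn : n.+1%:R * (t / n.+1%:R) = t by rewrite mulrC divfK// gt_eqF.
have := telescoping n.+1 (ltW tn0); rewrite tn => /le_trans; apply.
have : defect (t / n.+1%:R) <= e / K * (t / n.+1%:R).
  apply: hd => //=; rewrite sub0r normrN gtr0_norm//.
  by rewrite ltr_pdivrMr// mulrC -ltr_pdivrMr.
move=> hde; rewrite mulrA.
apply: (le_trans (ler_wpM2l _ hde)).
  by rewrite !mulr_ge0 ?expR_ge0 ?(ltW M0).
rewrite le_eqVlt; apply/orP; left; apply/eqP.
rewrite (_ : n.+1%:R * _ * _ = e / K * K); first by rewrite divfK// gt_eqF.
move: (t / _) tn => q tn.
rewrite (_ : e / K * K = e / K * (n.+1%:R * q * M * expR (`|complex.Re lam| * t))).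
  by move: (e / K) => c; ring.
by rewrite tn.
Qed.

End Eigenvector.

(** * Integrals of exponentials *)

Section IntegralAtMost.
Context {R : realType}.
Local Notation mu := (@lebesgue_measure R).
Implicit Types (t k a c : R) (g : R -> R).

(** Integrability is part of the definition so that the bounds can be added and
    scaled without further side conditions. *)
Definition integral_at_most (t : R) (g : R -> R) (c : R) : Prop :=
  mu.-integrable `[0, t] (EFin \o g) /\
  (\int[mu]_(s in `[0%R, t]) (g s)%:E <= c%:E)%E.

Lemma integral_at_mostD t g1 g2 c1 c2 :
  integral_at_most t g1 c1 -> integral_at_most t g2 c2 ->
  integral_at_most t (fun s => g1 s + g2 s) (c1 + c2).
Proof.
move=> [i1 h1] [i2 h2]; have mD : measurable (`[0, t] : set (measurableTypeR R)).
  exact: measurable_itv.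
split; first exact: (integrableD mD i1 i2).
have -> : (\int[mu]_(s in `[0%R, t]) (g1 s + g2 s)%:E =
    \int[mu]_(s in `[0%R, t]) (g1 s)%:E + \int[mu]_(s in `[0%R, t]) (g2 s)%:E)%E.
  exact: (integralD_EFin mD i1 i2).
by rewrite EFinD leeD.
Qed.

Lemma integral_at_mostZ t k g c : 0 <= k ->
  integral_at_most t g c -> integral_at_most t (fun s => k * g s) (k * c).
Proof.
move=> k0 [i1 h1]; have mD : measurable (`[0, t] : set (measurableTypeR R)).
  exact: measurable_itv.
split; first exact: (integrableZl mD k i1).
have -> : (\int[mu]_(s in `[0%R, t]) (k * g s)%:E =
    k%:E * \int[mu]_(s in `[0%R, t]) (g s)%:E)%E.
  by rewrite -(integralZl mD i1).
by rewrite EFinM lee_wpmul2l.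
Qed.

Lemma integral_at_most_cst t k : 0 <= t -> integral_at_most t (fun=> k) (k * t).
Proof.
move=> t0; have mD : measurable (`[0, t] : set (measurableTypeR R)).
  exact: measurable_itv.
have mu_itv : mu `[0, t] = t%:E.
  by rewrite lebesgue_measure_itv/= lte_fin; case: ltgtP t0 => // [_ _|<- _];
    rewrite ?subr0 ?oppr0 ?addr0.
split; last by rewrite integral_cst// EFinM -mu_itv.
apply: (@continuous_compact_integrable R (fun=> k)); first exact: segment_compact.
by apply: continuous_subspaceT => x; exact: cvg_cst.
Qed.

Lemma integral_at_most_sum t (I : eqType) (r : seq I) (g : I -> R -> R) (c : I -> R) :
  0 <= t -> (forall i, i \in r -> integral_at_most t (g i) (c i)) ->
  integral_at_most t (fun s => \sum_(i <- r) g i s) (\sum_(i <- r) c i).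
Proof.
move=> t0; elim: r => [_|i r IH gc].
  rewrite big_nil (_ : (fun=> _) = (fun=> 0)).
    by rewrite -{2}(mul0r t); exact: integral_at_most_cst.
  by apply/funext => s; rewrite big_nil.
rewrite big_cons (_ : (fun=> _) = (fun s => g i s + \sum_(j <- r) g j s)).
  apply: integral_at_mostD; first by apply: gc; rewrite mem_head.
  by apply: IH => j jr; apply: gc; rewrite in_cons jr orbT.
by apply/funext => s; rewrite big_cons.
Qed.

Lemma integral_at_most_expR t a : 0 <= t -> a < 0 ->
  integral_at_most t (fun s => expR (a * (t - s))) (- a)^-1.
Proof.
move=> t0 a0; have a0' : 0 < - a by rewrite oppr_gt0.
pose f (s : R) := expR (a * (t - s)).
pose F (s : R) := (- a)^-1 * f s.
have df (s : R) : is_derive s 1 f (- a * f s).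
  have dl : is_derive s 1 (fun s => a * (t - s)) (- a).
    have := is_deriveZ a
      (is_deriveB (is_derive_cst t s (1 : R)) (is_derive_id s (1 : R))).
    by rewrite sub0r /GRing.scale/= mulrN1.
  have := @is_derive1_comp R expR (fun s => a * (t - s)) s _ _ (is_derive_expR _) dl.
  by rewrite mulrC.
have dF (s : R) : is_derive s 1 F (f s).
  have := is_deriveZ (- a)^-1 (df s).
  by rewrite /GRing.scale/= mulrA mulVf ?mul1r// gt_eqF.
have cf : continuous f.
  by move=> s; apply/differentiable_continuous/derivable1_diffP; case: (df s).
have cF : continuous F.
  by move=> s; apply/differentiable_continuous/derivable1_diffP; case: (dF s).
split.
  apply: (@continuous_compact_integrable R f); first exact: segment_compact.
  exact: continuous_subspaceT.
move: t0; rewrite le_eqVlt => /predU1P[<-|t0].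
  by rewrite set_itv1 integral_set1 lee_fin invr_ge0 ltW.
rewrite (@continuous_FTC2 R f F 0 t)//.
- rewrite -EFinB lee_fin /F /f subrr mulr0 expR0 mulr1 gerBl.
  by rewrite mulr_ge0 ?expR_ge0// invr_ge0 ltW.
- exact: continuous_subspaceT.
- split => [s _||]; first by case: (dF s).
  + by apply: cvg_at_right_filter; exact: cF.
  + by apply: cvg_at_left_filter; exact: cF.
- by move=> s _; rewrite derive1E; case: (dF s).
Qed.

End IntegralAtMost.

(** * The spectral gap of a polynomially stable semigroup *)

Section SpectralGap.
Context {R : realType} {X : normedModType R[i]}.
Implicit Types t : R.
Variables (T : R -> X -> X) (S : X -> X) (alpha D CS t0 : R).
Hypotheses (alpha0 : 0 < alpha) (D0 : 0 < D) (CS0 : 0 < CS).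
Hypothesis S_bounded : forall x, rnorm (S x) <= CS * rnorm x.
Hypothesis decay : forall t x, t0 <= t ->
  rnorm (T t (S x)) <= D * t `^ (- alpha^-1) * rnorm x.

(** On an eigenvector the decay estimate says that the function
    [t * exp (alpha * Re lam * t)] is at most [(D * |lam|) ^ alpha] for large
    [t]; evaluated at [t = 1 / |Re lam|] this bounds [1 / |Re lam|] by a multiple
    of [|lam| ^ alpha]. *)
Lemma spectral_gap : exists2 K : R, 0 < K &
  forall (phi : X) lam, phi != 0 -> S (lam *: phi) = phi ->
    (forall t, 0 <= t -> T t phi = cexp lam t *: phi) ->
    complex.Re lam < 0 /\ (- complex.Re lam)^-1 <= K * rnorm lam `^ alpha.
Proof.
pose t1 := Num.max t0 1.
have t11 : 1 <= t1 by rewrite le_max lexx orbT.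
have t1p : 0 < t1 by exact: lt_le_trans ltr01 t11.
exists (expR alpha * D `^ alpha + t1 * CS `^ alpha).
  by rewrite addr_gt0// mulr_gt0 ?expR_gt0 ?powR_gt0.
move=> phi lam phi0 Sphi Tphi.
have nphi : 0 < rnorm phi by rewrite rnorm_gt0.
set a := complex.Re lam; set l := rnorm lam.
have l0 : 0 <= l by exact: rnorm_ge0.
have CSl : 1 <= CS * l.
  have := S_bounded (lam *: phi); rewrite Sphi rnormZ -/l mulrA.
  by rewrite ler_pMl.
have key (t : R) : t1 <= t -> t * expR (alpha * a * t) <= D `^ alpha * l `^ alpha.
  move=> t1t.
  have tp : 0 < t by exact: lt_le_trans t1t.
  have t0t : t0 <= t by apply: le_trans t1t; rewrite le_max lexx.
  have := decay (lam *: phi) t0t; rewrite Sphi Tphi ?(ltW tp)//.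
  rewrite !rnormZ rnorm_cexp -/a -/l mulrA ler_pM2r// => h.
  have al0 : 0 <= alpha by exact: ltW.
  have := @ge0_ler_powR _ alpha al0 _ _ _ _ h.
  rewrite !nnegrE expR_ge0 !mulr_ge0 ?powR_ge0 ?(ltW D0)// => /(_ isT isT).
  rewrite -expRM !powRM ?mulr_ge0 ?powR_ge0 ?(ltW D0)//.
  rewrite -powRrM mulNr mulVf ?gt_eqF// powR_inv1 ?(ltW tp)//.
  rewrite (_ : a * t * alpha = alpha * a * t); last by ring.
  by rewrite [X in _ <= X -> _]mulrAC ler_pdivlMr// [t * _]mulrC.
have alow : a < 0.
  rewrite ltNge; apply/negP => a0.
  (* a time at which [key] fails when [a] is nonnegative *)
  pose t := t1 + D `^ alpha * l `^ alpha.
  have c0 : 0 <= D `^ alpha * l `^ alpha by rewrite mulr_ge0 ?powR_ge0.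
  have t1t : t1 <= t by rewrite lerDl.
  have tp : 0 < t by exact: lt_le_trans t1t.
  have := key _ t1t; apply/negP; rewrite -ltNge.
  apply: (@lt_le_trans _ _ t); first by rewrite ltrDr.
  rewrite ler_peMr ?(ltW tp)// -expR0 ler_expR.
  by rewrite !mulr_ge0// ltW.
split => //.
have a0 : 0 < - a by rewrite oppr_gt0.
(* when [1 / |Re lam|] is below [t1], where no decay is assumed, it is enough that
   [|lam|] is at least [1 / CS] *)
have [ta|/ltW ta] := leP t1 (- a)^-1.
  have := key _ ta.
  rewrite (_ : alpha * a * (- a)^-1 = - alpha); last first.
    by rewrite invrN mulrN mulfK// lt_eqF.
  rewrite expRN ler_pdivrMr ?expR_gt0// => /le_trans; apply.
  rewrite mulrC mulrDl mulrA lerDl.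
  by rewrite !mulr_ge0 ?powR_ge0// ltW.
apply: (le_trans ta).
apply: (@le_trans _ _ (t1 * (CS `^ alpha * l `^ alpha))).
  rewrite ler_peMr ?(ltW t1p)// -powRM ?(ltW CS0)//.
  rewrite -[leLHS](_ : 1 `^ alpha = 1); last by rewrite -expR0 -expRM mul0r.
  by rewrite ge0_ler_powR ?nnegrE ?(ltW alpha0)// mulr_ge0// ltW.
by rewrite mulrDl mulrA lerDr !mulr_ge0 ?expR_ge0 ?powR_ge0.
Qed.

End SpectralGap.

(** * Integrability of the orbits starting in the domain of the fractional power *)

Section Orbit.
Context {R : realType} {X : normedModType R[i]}.
Implicit Types t r : R.
Variable ip : {dot X for (@Num.conj R[i])}.
Hypothesis hilbert_norm : forall x : X, `|x| ^+ 2 = ip x x.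
Variables (T : R -> X -> X) (M K alpha Q : R).
Hypothesis semigroup : C0_semigroup T.
Hypothesis bounded : forall t (x : X), 0 <= t -> rnorm (T t x) <= M * rnorm x.
Hypothesis M1 : 1 <= M.
Variables (phi psi : nat -> X) (lam : nat -> R[i]) (b : X).
Hypothesis basis : riesz_basis phi.
Hypothesis bio : biorthogonal ip phi psi.
Hypothesis T_phi : forall n t, 0 <= t -> T t (phi n) = cexp (lam n) t *: phi n.
Hypothesis K0 : 0 < K.
Hypothesis gap : forall n, complex.Re (lam n) < 0 /\
  (- complex.Re (lam n))^-1 <= K * rnorm (lam n) `^ alpha.
Hypothesis b_frac : forall N,
  \sum_(n < N) rnorm (lam n) `^ (2 * alpha) * rnorm (ip b (psi n)) ^+ 2 <= Q.

(** Term by term in the expansion of [b], the integral of the orbit tested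
    against [y] is at most the sum of [|b_n| |ip (phi n) y| / |Re lam_n|].  By the
    gap this is at most the sum of [K |lam_n|^alpha |b_n| |ip (phi n) y|], and the
    arithmetic-geometric mean inequality with weight [rnorm y] splits it into a sum
    that is finite for [b] in the domain of the fractional power and one that
    Bessel's inequality bounds.  Truncating the expansion costs an arbitrarily
    small constant [eta], which keeps the majorant a finite sum of exponentials. *)
Lemma orbit_integral_bound : exists2 C : R, 0 <= C &
  forall (y : X) t (eta : R), 0 <= t -> 0 < eta ->
  exists g : R -> R, integral_at_most t g (C * rnorm y + eta * t) /\
    forall s : R, 0 <= s <= t -> rnorm (ip (T (t - s) b) y) <= g s.
Proof.
have M0 : 0 < M by exact: lt_le_trans ltr01 M1.
have [m [M' [m0 M'0 hmM]]] := basis.2.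
have bessel := riesz_bessel hilbert_norm (fun N a => (andP (hmM N a)).2) M'0.
have Q0 : 0 <= Q by have := b_frac 0; rewrite big_ord0.
exists (K / 2 * (Q + M')).
  by rewrite mulr_ge0 ?divr_ge0 ?addr_ge0// ltW.
move=> y t eta t0 eta0.
have [->|y0] := eqVneq y 0.
  exists (fun=> eta); split.
    by rewrite rnorm0 mulr0 add0r; exact: integral_at_most_cst.
  by move=> s _; rewrite linear0r rnorm0 ltW.
have ny : 0 < rnorm y by rewrite rnorm_gt0.
have e0 : 0 < eta / (M * rnorm y) by rewrite divr_gt0// mulr_gt0.
have [N bN] := partial_expansion_cvg hilbert_norm basis bio b e0.
pose p (n : nat) := rnorm (ip b (psi n)) * rnorm (ip (phi n) y).
pose a (n : nat) := complex.Re (lam n).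
pose g s := \sum_(n < N) p n * expR (a n * (t - s)) + eta.
exists g; split; last first.
  move=> s /andP[s0 st]; have ts : 0 <= t - s by rewrite subr_ge0.
  have [/(_ _ ts)[lT _] _ _ _] := semigroup.
  set bN' := partial_expansion ip phi psi N b.
  have := lT 1 bN' (b - bN'); rewrite !scale1r [bN' + _]addrC subrK => ->.
  rewrite ipDl.
  rewrite (le_trans (ler_rnormD _ _))// /g lerD//.
    rewrite (semigroup_sum semigroup)// ip_suml (le_trans (ler_rnorm_sum _ _ _))//.
    apply: ler_sum => n _.
    rewrite (semigroupZ semigroup)// T_phi// !ipZl !rnormM rnorm_cexp /p -/(a n).
    by rewrite le_eqVlt; apply/orP; left; apply/eqP; ring.
  apply: (le_trans (cauchy_schwarz hilbert_norm _ _)).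
  apply: (le_trans (ler_wpM2r (rnorm_ge0 _) (bounded _ ts))).
  by rewrite mulrAC mulrC -ler_pdivlMr ?mulr_gt0// ltW.
have at_most : integral_at_most t g (\sum_(n < N) p n * (- a n)^-1 + eta * t).
  apply: integral_at_mostD; last exact: integral_at_most_cst.
  apply: integral_at_most_sum => // n _; apply: integral_at_mostZ.
    by rewrite mulr_ge0 ?rnorm_ge0.
  by apply: integral_at_most_expR => //; have [] := gap n.
have [ig ig_le] := at_most; split => //; apply: (le_trans ig_le).
rewrite lee_fin lerD2r.
pose A n := rnorm (lam n) `^ (2 * alpha) * rnorm (ip b (psi n)) ^+ 2.
pose W n := rnorm (ip (phi n) y) ^+ 2.
have term (n : nat) : p n * (- a n)^-1 <= K / 2 * (rnorm y * A n + (rnorm y)^-1 * W n).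
  have p0 : 0 <= p n by rewrite mulr_ge0 ?rnorm_ge0.
  apply: (le_trans (ler_wpM2l p0 (gap n).2)).
  pose l := rnorm (lam n) `^ alpha.
  have -> : A n = (l * rnorm (ip b (psi n))) ^+ 2.
    by rewrite exprMn /A mulrC [2 * alpha]mulrC powRrM powR_mulrn ?powR_ge0// mulrC.
  rewrite /W /p -/l.
  set x := rnorm (ip b (psi n)); set z := rnorm (ip (phi n) y); set q := rnorm y.
  have q0 : q != 0 by rewrite gt_eqF.
  (* arithmetic-geometric mean inequality with weight [q] *)
  have : 0 <= K / 2 * (q^-1 * (q * (l * x) - z) ^+ 2).
    apply: mulr_ge0; first by rewrite divr_ge0// ltW.
    by rewrite mulr_ge0 ?sqr_ge0// invr_ge0 rnorm_ge0.
  have -> : K / 2 * (q^-1 * (q * (l * x) - z) ^+ 2) =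
    K / 2 * (q * (l * x) ^+ 2 + q^-1 * z ^+ 2) - x * z * (K * l) by field.
  by rewrite subr_ge0.
apply: (@le_trans _ _ (\sum_(n < N) K / 2 * (rnorm y * A n + (rnorm y)^-1 * W n))).
  by apply: ler_sum => n _; exact: term.
rewrite -mulr_sumr big_split/= -!mulr_sumr -[leRHS]mulrA ler_pM2l ?divr_gt0//.
rewrite mulrDl lerD//.
  by rewrite [leLHS]mulrC ler_wpM2r ?rnorm_ge0//; exact: b_frac.
apply: (@le_trans _ _ ((rnorm y)^-1 * (M' * rnorm y ^+ 2))).
  by rewrite ler_wpM2l ?invr_ge0 ?rnorm_ge0//; exact: bessel.
rewrite le_eqVlt; apply/orP; left; apply/eqP; field.
by rewrite gt_eqF.
Qed.

End Orbit.

(** * Comparison functions *)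

Section Comparison.
Context {R : realType}.
Implicit Types c r t p : R.

Lemma classK_linear c : 0 < c -> classK (fun r => c * r).
Proof.
move=> c0; split.
- by apply: continuous_subspaceT => x; apply: cvgM; [exact: cvg_cst|exact: cvg_id].
- by move=> r r0; rewrite mulr_ge0// ltW.
- by move=> r s _ rs; rewrite ltr_pM2l.
- by rewrite mulr0.
Qed.

Lemma classKoo_linear c : 0 < c -> classKoo (fun r => c * r).
Proof.
move=> c0; split; first exact: classK_linear.
move=> M; exists ((`|M| + 1) / c); first by rewrite divr_ge0 ?addr_ge0// ltW.
by rewrite mulrC divfK ?gt_eqF// (le_lt_trans (ler_norm M))// ltrDl.
Qed.

Lemma powRDl1_gt0 p t : 0 <= t -> 0 < (1 + t) `^ p.
Proof. by move=> t0; rewrite powR_gt0// ltr_pwDl. Qed.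

Lemma powRDl1_continuous p t : 0 <= t -> {for t, continuous (fun t => (1 + t) `^ p)}.
Proof.
move=> t0; have t1 : 0 < 1 + t by rewrite ltr_pwDl.
have h1 : (1 + s) @[s --> t] --> 1 + t.
  by apply: cvgD; [exact: cvg_cst|exact: cvg_id].
have h2 : {for 1 + t, continuous (fun s : R => s `^ p)}.
  apply/differentiable_continuous/derivable1_diffP/derivable_powR.
  by rewrite in_itv/= t1.
exact: (cvg_comp _ _ h1 h2).
Qed.

Lemma classKL_power c p : 0 < c -> 0 < p -> classKL (fun r t => c * r * (1 + t) `^ (- p)).
Proof.
move=> c0 p0; split.
- apply: continuous_in_subspaceT => -[r t]; rewrite inE => -[/= r0 t0].
  have h1 : (fst q : R) @[q --> ((r, t) : R * R)] --> r by exact: cvg_fst.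
  have h2 : (snd q : R) @[q --> ((r, t) : R * R)] --> t by exact: cvg_snd.
  have h3 : (c * fst q : R) @[q --> ((r, t) : R * R)] --> c * r.
    by apply: (cvgM _ h1); exact: cvg_cst.
  have h4 : ((1 + snd q) `^ (- p) : R) @[q --> ((r, t) : R * R)] --> (1 + t) `^ (- p).
    exact: (cvg_comp _ _ h2 (powRDl1_continuous (p := - p) t0)).
  exact: (cvgM h3 h4).
- move=> t t0; rewrite (_ : (fun r => _) = fun r => (c * (1 + t) `^ (- p)) * r).
    by apply: classK_linear; rewrite mulr_gt0// powRDl1_gt0.
  by apply/funext => r; rewrite mulrAC.
- move=> r r0; have cr : 0 < c * r by rewrite mulr_gt0.
  split.
  + apply: continuous_in_subspaceT => t /set_mem; rewrite /= in_itv/= andbT => t0.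
    by apply: cvgM; [exact: cvg_cst|exact: powRDl1_continuous].
  + by move=> t t0; rewrite mulr_ge0 ?powR_ge0// ltW.
  + move=> s t s0 st; have t0 : 0 <= t by exact: le_trans s0 (ltW st).
    rewrite ltr_pM2l// !powRN ltf_pV2 ?posrE ?powRDl1_gt0//.
    by rewrite gt0_ltr_powR ?nnegrE ?addr_ge0 ?ltrD2l.
  + apply/cvgrPdist_lt => e e0; near=> t.
    have t0 : 0 <= t by near: t; exact: nbhs_pinfty_ge.
    rewrite sub0r normrN ger0_norm; last first.
      by apply: mulr_ge0; [exact: ltW|exact: powR_ge0].
    rewrite powRN ltr_pdivrMr ?powRDl1_gt0// [e * _]mulrC -ltr_pdivrMr//.
    have ecr : 0 < c * r / e by rewrite divr_gt0.
    have ht : (c * r / e) `^ p^-1 < t by near: t; exact: nbhs_pinfty_gt.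
    have <- : ((c * r / e) `^ p^-1) `^ p = c * r / e.
      by rewrite -powRrM mulVf ?gt_eqF// powRr1// ltW.
    rewrite gt0_ltr_powR ?nnegrE ?powR_ge0 ?addr_ge0//.
    by rewrite (lt_trans ht)// ltrDr.
Unshelve. all: by end_near. Qed.

End Comparison.

(** * Input-to-state estimates *)

Section LinearSystem.
Context {R : realType} {U X : normedModType R[i]}.

(** [opnorm] only looks at the unit ball; homogeneity extends the bound. *)
Lemma opnorm_homogeneous_le (L : X -> X) (c : R) :
  (forall a x, L (a *: x) = a *: L x) -> (opnorm L <= c%:E)%E ->
  forall x, rnorm (L x) <= c * rnorm x.
Proof.
move=> LZ Lc x; have [->|x0] := eqVneq x 0.
  have := LZ 0 0; rewrite !scale0r => ->.
  by rewrite !rnorm0 mulr0.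
have nx : 0 < rnorm x by rewrite rnorm_gt0.
rewrite -ler_pdivrMr// -lee_fin (le_trans _ Lc)//.
apply: ereal_sup_ubound; exists ((rnorm x)^-1%:C *: x) => /=.
  by rewrite rnormZ rnormC ger0_norm ?invr_ge0 ?rnorm_ge0// mulVf// gt_eqF.
by rewrite LZ rnormZ rnormC ger0_norm ?invr_ge0 ?rnorm_ge0// mulrC.
Qed.

Lemma Linfty_ae_le (u : R -> U) : Linfty u ->
  0 <= norm_Linfty u /\
  {ae (@lebesgue_measure R), forall s : R, 0 <= s -> rnorm (u s) <= norm_Linfty u}.
Proof.
move=> [_ uoo]; rewrite /norm_Linfty.
have u0 : (0 <= ess_norm u)%E.
  apply: ess_sup_ger.
    have := @lebesgue_measure_itv R `]-oo, +oo[; rewrite set_itvNyy/= => ->.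
    by rewrite adde_gt0.
  by move=> t; rewrite lee_fin patchE; case: ifPn => // _; exact: rnorm_ge0.
have uE : ess_norm u = (fine (ess_norm u))%:E by rewrite fineK// ge0_fin_numE.
split; first by rewrite fine_ge0.
have := ess_sup_ge (@lebesgue_measure R)
  (fun t : R => (((fun s : R => rnorm (u s)) \_ `[0, +oo[) t)%:E).
apply: filterS => s + s0.
rewrite -/(ess_norm u) uE lee_fin patchE ifT//.
by rewrite inE/= in_itv/= s0.
Qed.

Variable ip : {dot X for (@Num.conj R[i])}.
Hypothesis hilbert_norm : forall x : X, `|x| ^+ 2 = ip x x.
Variables (T : R -> X -> X) (B : {linear U -> X}).
Hypothesis semigroup : C0_semigroup T.

(** The functional [Re (ip _ v)] takes the value [rnorm v ^+ 2] at the Bochner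
    integral [v], so it suffices to bound it on the integrand: there
    [B (u s)] is a combination of finitely many fixed vectors [y], with
    coefficients bounded by the norm of [u], of which the orbits tested against
    [v] have integrable majorants. *)
Lemma convolution_bound (CB : R) (e : seq X) :
  0 <= CB -> (forall w, rnorm (B w) <= CB * rnorm w) ->
  (forall w, B w = \sum_(y <- e) ip (B w) y *: y) ->
  (forall y, y \in e -> rnorm y = 1) ->
  (forall y, y \in e -> exists2 C : R, 0 <= C &
    forall (z : X) (t eta : R), 0 <= t -> 0 < eta ->
    exists g : R -> R, integral_at_most t g (C * rnorm z + eta * t) /\
      forall s : R, 0 <= s <= t -> rnorm (ip (T (t - s) y) z) <= g s) ->
  exists2 C : R, 0 <= C & forall (u : R -> U) (t : R) (v : X), Linfty u -> 0 <= t ->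
    is_bochner_integral `[0, t] (fun s => T (t - s) (B (u s))) v ->
    rnorm v <= C * norm_Linfty u.
Proof.
move=> CB0 B_le B_e e_unit e_orbit.
have /choice[C HC] : forall y, exists C : R, y \in e -> 0 <= C /\
    forall (z : X) (t eta : R), 0 <= t -> 0 < eta ->
    exists g : R -> R, integral_at_most t g (C * rnorm z + eta * t) /\
      forall s : R, 0 <= s <= t -> rnorm (ip (T (t - s) y) z) <= g s.
  move=> y; have [ye|_] := boolP (y \in e); last by exists 0.
  by have [C C0 HC] := e_orbit y ye; exists C.
pose Ce : R := \sum_(y <- e) C y.
have Ce0 : 0 <= Ce by rewrite /Ce big_seq sumr_ge0// => y /HC[].
exists (CB * Ce); first by rewrite mulr_ge0.
move=> u t v uL t0 hv.
have [u0 uae] := Linfty_ae_le uL; set w := norm_Linfty u in u0 uae *.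
have nv := rnorm_ge0 v.
pose L x := complex.Re (ip x v).
have LD : {morph L : x y / x + y} by move=> x y; rewrite /L ipDl ReD.
have LZ r x : L (r%:C *: x) = r * L x by rewrite /L ipZl ReZ.
have Lle x : L x <= (rnorm v + 1) * rnorm x.
  rewrite (le_trans (Re_le_rnorm _))// (le_trans (cauchy_schwarz hilbert_norm _ _))//.
  by rewrite mulrC ler_wpM2r ?rnorm_ge0// lerDl.
have v1 : 0 < rnorm v + 1 by rewrite ltr_wpDl.
have Lv : L v = rnorm v ^+ 2 by rewrite /L (ip_self hilbert_norm).
have key (eta : R) : 0 < eta ->
    rnorm v ^+ 2 <= CB * w * (Ce * rnorm v + eta * t * (size e)%:R).
  move=> eta0.
  have /choice[g Hg] : forall y, exists g : R -> R, y \in e ->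
      integral_at_most t g (C y * rnorm v + eta * t) /\
      forall s : R, 0 <= s <= t -> rnorm (ip (T (t - s) y) v) <= g s.
    move=> y; have [ye|_] := boolP (y \in e); last by exists (fun=> 0).
    by have [_ /(_ v t eta t0 eta0)[g gy]] := HC y ye; exists g.
  pose G s := CB * w * \sum_(y <- e) g y s.
  have [iG leG] : integral_at_most t G (CB * w * (Ce * rnorm v + eta * t * (size e)%:R)).
    apply: integral_at_mostZ; first by rewrite mulr_ge0.
    have -> : Ce * rnorm v + eta * t * (size e)%:R =
        \sum_(y <- e) (C y * rnorm v + eta * t).
      rewrite big_split/= -mulr_suml; congr (_ + _).
      by rewrite big_const_seq count_predT iter_addr addr0 mulr_natr.
    by apply: integral_at_most_sum => // y ye; have [] := Hg y ye.
  rewrite -Lv -lee_fin (le_trans _ leG)//.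
  apply: (functional_bochner_le LD LZ v1 Lle _ iG _ hv); first exact: measurable_itv.
  apply: (@filterS _ _ (ae_filter_ringOfSetsType _) _ _ _ uae) => s us.
  rewrite /= in_itv/= => /andP[s0 st].
  have ts : 0 <= t - s by rewrite subr_ge0.
  rewrite /L (le_trans (Re_le_rnorm _))// B_e (semigroup_sum semigroup)// ip_suml.
  rewrite (le_trans (ler_rnorm_sum _ _ _))// /G mulr_sumr big_seq [leRHS]big_seq.
  apply: ler_sum => y ye.
  rewrite (semigroupZ semigroup)// ipZl rnormM ler_pM ?rnorm_ge0//.
    rewrite (le_trans (cauchy_schwarz hilbert_norm _ _))// (e_unit y)// mulr1.
    by rewrite (le_trans (B_le _))// ler_wpM2l// us.
  by have [_ gy] := Hg y ye; apply: gy; rewrite s0.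
have [->|v0] := eqVneq (rnorm v) 0; first by rewrite !mulr_ge0.
have vp : 0 < rnorm v by rewrite lt_neqAle eq_sym v0.
rewrite -(ler_pM2r vp) -expr2.
(* the constant [eta] of the majorants is sent to zero, [t] and [u] being fixed *)
suff H (d : R) : 0 < d -> rnorm v ^+ 2 <= CB * Ce * w * rnorm v + d.
  by apply/ler_addgt0Pr => d; exact: H.
move=> d0; pose k := CB * w * (t * (size e)%:R).
have k0 : 0 <= k by rewrite !mulr_ge0.
have dk : 0 < d / (k + 1) by rewrite divr_gt0// ltr_wpDl.
have := key _ dk; move/le_trans; apply.
have -> : CB * w * (Ce * rnorm v + d / (k + 1) * t * (size e)%:R) =
  CB * Ce * w * rnorm v + d / (k + 1) * k by rewrite /k; ring.
rewrite lerD2l mulrAC ler_pdivrMr ?ltr_wpDl//.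
by rewrite ler_pM2l// lerDl.
Qed.

End LinearSystem.

Section FractionalDomain.
Context {R : realType} {X : normedModType R[i]}.
Variable ip : {dot X for (@Num.conj R[i])}.
Hypothesis hilbert_norm : forall x : X, `|x| ^+ 2 = ip x x.
Variables (A : unbounded_op X) (T : R -> X -> X) (alpha : R).
Hypothesis alpha0 : 0 < alpha.
Hypothesis semigroup : C0_semigroup T.
Hypothesis generator : is_generator A T.
Hypothesis stable : polynomially_stable A T alpha.

Lemma stable_bounded : exists2 M : R, 1 <= M &
  forall (t : R) (x : X), 0 <= t -> rnorm (T t x) <= M * rnorm x.
Proof.
have [[[M hM] _] _] := stable.
exists (Num.max M 1); first by rewrite le_max lexx orbT.
move=> t x t0; rewrite (le_trans (hM t x t0))// ler_wpM2r ?rnorm_ge0//.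
by rewrite le_max lexx.
Qed.

Lemma stable_decay : exists (S : X -> X) (CS D t0 : R),
  [/\ 0 < CS, 0 < D, forall x, odom A x -> S (A x) = x,
      forall x, rnorm (S x) <= CS * rnorm x
    & forall (t : R) x, t0 <= t -> 0 <= t ->
        rnorm (T t (S x)) <= D * t `^ (- alpha^-1) * rnorm x].
Proof.
have [_ [S [[lS cS _ SA] [D [t0 [D0 hD]]]]]] := stable.
have [CS CS0 hCS] := linear_continuous_rbounded lS cS.
exists S, CS, D, t0; split => // t x t0t tp.
apply: (@opnorm_homogeneous_le _ _ (fun x => T t (S x))); last exact: hD.
move=> a z; have SZ : S (a *: z) = a *: S z.
  have S0 : S 0 = 0 by have := lS (-1) 0 0; rewrite scaler0 addr0 scaleN1r addNr.
  by have := lS a z 0; rewrite S0 !addr0.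
by rewrite SZ (semigroupZ semigroup).
Qed.

(** The eigenbasis may depend on [b]: the constants of the gap come from the
    semigroup alone. *)
Lemma fractional_domain_orbit_bound b : dom_fractional_power ip A alpha b ->
  exists2 C : R, 0 <= C & forall (y : X) (t eta : R), 0 <= t -> 0 < eta ->
    exists g : R -> R, integral_at_most t g (C * rnorm y + eta * t) /\
      forall s : R, 0 <= s <= t -> rnorm (ip (T (t - s) b) y) <= g s.
Proof.
move=> [phi [lam [psi [[basis eigen] bio b_series]]]].
have [M M1 bounded] := stable_bounded.
have [S [CS [D [t0 [CS0 D0 SA hCS decay]]]]] := stable_decay.
have decay' (t : R) x : Num.max t0 0 <= t ->
    rnorm (T t (S x)) <= D * t `^ (- alpha^-1) * rnorm x.
  by rewrite ge_max => /andP[? ?]; exact: decay.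
have [K K0 gap] := spectral_gap alpha0 D0 CS0 hCS decay'.
have T_phi n (t : R) : 0 <= t -> T t (phi n) = cexp (lam n) t *: phi n.
  have [Dphi Aphi] := eigen n.
  apply: (semigroup_eigenvector semigroup bounded M1).
  by rewrite -Aphi; exact: generator.2.
have phi_gap n : complex.Re (lam n) < 0 /\
    (- complex.Re (lam n))^-1 <= K * rnorm (lam n) `^ alpha.
  apply: gap (T_phi n); last by rewrite -(eigen n).2 SA//; exact: (eigen n).1.
  apply/eqP => phi0; have := bio n n.
  by rewrite phi0 linear0l eqxx => /esym/eqP; rewrite oner_eq0.
pose a n := rnorm (lam n) `^ (2 * alpha) * rnorm (ip b (psi n)) ^+ 2.
have a0 n : 0 <= a n by rewrite mulr_ge0 ?powR_ge0 ?sqr_ge0.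
have b_frac N : \sum_(n < N) a n <= fine (\sum_(0 <= n <oo) (a n)%:E)%E.
  rewrite -lee_fin fineK; last first.
    by rewrite ge0_fin_numE// nneseries_ge0// => n _ _; rewrite lee_fin.
  rewrite -sumEFin -(big_mkord xpredT (fun n => (a n)%:E)).
  by apply: nneseries_lim_ge => n _ _; rewrite lee_fin.
exact: (orbit_integral_bound hilbert_norm semigroup bounded M1 basis bio T_phi K0
  phi_gap b_frac).
Qed.

(** On the domain of [A] an orbit factors as [T t (S (A x))], which decays for
    large [t]; for the remaining [t] the uniform bound is absorbed in [c]. *)
Lemma domain_decay : exists2 c : R, 0 < c & forall x (t : R), odom A x -> 0 <= t ->
  rnorm (T t x) <= c * graph_norm A x * (1 + t) `^ (- alpha^-1).
Proof.
have [M M1 bounded] := stable_bounded.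
have [S [CS [D [t0 [CS0 D0 SA hCS decay]]]]] := stable_decay.
pose p := alpha^-1; have p0 : 0 < p by rewrite invr_gt0.
pose t1 := Num.max t0 1.
have t11 : 1 <= t1 by rewrite le_max lexx orbT.
have M0 : 0 < M by exact: lt_le_trans ltr01 M1.
have t1p : 0 <= t1 by exact: le_trans t11.
pose c1 := D * 2 `^ p; pose c2 := M * (1 + t1) `^ p.
have c10 : 0 < c1 by rewrite mulr_gt0// powR_gt0.
have c20 : 0 < c2 by rewrite mulr_gt0// powRDl1_gt0.
exists (c1 + c2) => [|x t Ax tp]; first by rewrite addr_gt0.
have tpp : 0 < (1 + t) `^ p by exact: powRDl1_gt0.
rewrite -/p powRN ler_pdivlMr//.
have gx : rnorm x <= graph_norm A x by rewrite lerDl rnorm_ge0.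
have gAx : rnorm (A x) <= graph_norm A x by rewrite lerDr rnorm_ge0.
have g0 : 0 <= graph_norm A x by rewrite addr_ge0 ?rnorm_ge0.
rewrite mulrDl; have [t1t|/ltW tt1] := leP t1 t.
  apply: (@le_trans _ _ (c1 * graph_norm A x)); last by rewrite lerDl mulr_ge0// ltW.
  have t_1 : 1 <= t by exact: le_trans t1t.
  have t_0 : 0 < t by exact: lt_le_trans t_1.
  have tpow : 0 < t `^ p by rewrite powR_gt0.
  have dec : rnorm (T t x) <= D * t `^ (- p) * rnorm (A x).
    rewrite -{1}(SA x Ax); apply: decay => //.
    by apply: le_trans t1t; rewrite le_max lexx.
  have pow2 : (1 + t) `^ p <= 2 `^ p * t `^ p.
    rewrite -powRM ?(ltW t_0)// ge0_ler_powR ?nnegrE ?addr_ge0 ?mulr_ge0 ?(ltW p0)//.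
    by rewrite mulr_natl mulr2n lerD2r.
  apply: (@le_trans _ _ (D * t `^ (- p) * graph_norm A x * (2 `^ p * t `^ p))).
    apply: ler_pM => //; rewrite ?rnorm_ge0 ?powR_ge0//.
    by rewrite (le_trans dec)// ler_wpM2l// mulr_ge0 ?powR_ge0// ltW.
  rewrite powRN le_eqVlt; apply/orP; left; apply/eqP; rewrite /c1; field.
  by rewrite gt_eqF.
apply: (@le_trans _ _ (c2 * graph_norm A x)); last by rewrite lerDr mulr_ge0// ltW.
rewrite /c2 mulrAC ler_pM ?rnorm_ge0 ?powR_ge0//.
  by rewrite (le_trans (bounded _ _ tp))// ler_pM2l.
by rewrite ge0_ler_powR ?nnegrE ?addr_ge0 ?(ltW p0)// lerD2l.
Qed.

End FractionalDomain.

Theorem theorem4p8 (R : realType) (X : completeNormedModType R[i])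
    (ip : {dot X for (@Num.conj R[i])})
    (hilbert_norm : forall x : X, `|x| ^+ 2 = ip x x)
    (U : completeNormedModType R[i])
    (A : unbounded_op X) (T : R -> X -> X) (B : {linear U -> X}) (alpha : R) :
  0 < alpha ->
  diagonalizable_op A ->
  C0_semigroup T ->
  is_generator A T ->
  polynomially_stable A T alpha ->
  continuous B ->
  finite_rank B ->
  range B `<=` dom_fractional_power ip A alpha ->
  polynomially_ISS A T B alpha.
Proof.
move=> alpha0 _ semigroup generator stable Bcont [n [b Bb]] Brange.
have [M M1 bounded] := stable_bounded stable.
have M0 : 0 < M by exact: lt_le_trans ltr01 M1.
have [CB CB0 B_le] := linear_continuous_rbounded (linearP B) Bcont.
have [|a _ _ [x _ <-] [y _ <-]|_ [w _ <-]|e [eB eE]] :=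
    orthonormal_expansion hilbert_norm (V := range B) (b := b).
- by exists 0; rewrite ?linear0.
- by exists (a *: x + y); rewrite ?linearP.
- exact: Bb.
have [C C0 hC] : exists2 C : R, 0 <= C &
    forall (u : R -> U) (t : R) (v : X), Linfty u -> 0 <= t ->
    is_bochner_integral `[0, t] (fun s => T (t - s) (B (u s))) v ->
    rnorm v <= C * norm_Linfty u.
  apply: (convolution_bound hilbert_norm semigroup (ltW CB0) B_le (e := e)).
  - by move=> w; apply: eE; exists w.
  - by move=> y /eB[].
  - move=> y /eB[By _].
    exact: (fractional_domain_orbit_bound hilbert_norm alpha0 semigroup generator stable)
      (Brange y By).
have C1 : 0 < C + 1 by rewrite ltr_wpDl.
have input_bound (u : R -> U) (t : R) : Linfty u -> 0 <= t ->
    rnorm (bochner_integral `[0, t] (fun s => T (t - s) (B (u s))))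
      <= (C + 1) * norm_Linfty u.
  move=> uL t0; have [u0 _] := Linfty_ae_le uL.
  (* the bound holds for every Bochner integral and for the default value *)
  rewrite /bochner_integral; case: xgetP => [v _ hv|_].
    by rewrite (le_trans (hC u t v uL t0 hv))// ler_wpM2r// lerDl.
  by rewrite rnorm0 mulr_ge0// ltW.
split.
  exists (fun r => M * r), (fun r => (C + 1) * r); split.
  - exact: classKoo_linear.
  - exact: classKoo_linear.
  - move=> x0 u t uL t0; rewrite (le_trans (ler_rnormD _ _))// lerD//.
      exact: bounded.
    exact: input_bound.
have [c c0 hc] := domain_decay alpha0 semigroup stable.
exists (fun r t => c * r * (1 + t) `^ (- alpha^-1)), (fun r => (C + 1) * r); split.
- by apply: classKL_power; rewrite ?invr_gt0.
- exact: classKoo_linear.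
- move=> x0 u t Ax uL t0; rewrite (le_trans (ler_rnormD _ _))// lerD//.
    exact: hc.
  exact: input_bound.
- move=> r r0; exists (c * r), 1; split; first by rewrite mulr_gt0.
  move=> t t1; have t0 : 0 < t by exact: lt_le_trans t1.
  rewrite lee_fin ler_pM2l ?mulr_gt0// !powRN lef_pV2 ?posrE ?powR_gt0 ?addr_gt0//.
  rewrite ge0_ler_powR ?nnegrE ?addr_ge0 ?invr_ge0 ?(ltW alpha0) ?(ltW t0)//.
  by rewrite lerDr.
Qed.
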